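(* Let $\mathfrak{g}$ be a real semisimple Lie algebra, $R:\mathfrak{g}\to\mathfrak{g}$ a skew-symmetric solution of the modified classical Yang-Baxter equation with $c=1$ or $c=i$, and let $\gamma\in\mathbb{R}$. Let $g(\sigma)\in G$ and $X(\sigma)\in\mathfrak{g}$, $\sigma\in\mathbb{R}$, be fields with Poisson brackets $$\{g_1(\sigma),g_2(\sigma')\}=0,\quad \{X_1(\sigma),g_2(\sigma')\}=g_2(\sigma)C_{12}\,\delta_{\sigma\sigma'},\quad \{X_1(\sigma),X_2(\sigma')\}=-[C_{12},X_2(\sigma)]\,\delta_{\sigma\sigma'},$$ with $X(\sigma)\to0$ as $\sigma\to\pm\infty$, and put $\mathcal{L}^g(\lambda_\pm,\sigma)=\gamma R^\pm X(\sigma)$ and $$T^g(\lambda_\pm)=\mathrm{P}\overleftarrow{\exp}\left(-\int_{-\infty}^{+\infty}d\sigma\,\mathcal{L}^g(\lambda_\pm,\sigma)\right).$$ Then $\Gamma^\pm=T^g(\lambda_\pm)$ satisfy the Semenov-Tian-Shansky Poisson brackets $$\{T^g_1(\lambda_\pm),T^g_2(\lambda_\pm)\}=\gamma\,[R_{12},T^g_1(\lambda_\pm)T^g_2(\lambda_\pm)],\qquad \{T^g_1(\lambda_\pm),T^g_2(\lambda_\mp)\}=\gamma\,[R^\pm_{12},T^g_1(\lambda_\pm)T^g_2(\lambda_\mp)].$$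
   Context: The modified classical Yang-Baxter equation (mCYBE) is $[RX,RY]-R([RX,Y]+[X,RY])=-c^2[X,Y]$ for all $X,Y\in\mathfrak{g}$; skew-symmetry is with respect to the Killing form $\kappa$. $R^\pm=R\pm c\,\mathrm{Id}$ (acting from $\mathfrak{g}$ to $\mathfrak{g}$ if $c=1$, to the complexification $\mathfrak{g}^{\mathbb{C}}$ if $c=i$). $C_{12}$ is the quadratic Casimir (kernel of the identity), and $R_{12}$, $R^\pm_{12}=R_{12}\pm c\,C_{12}$ are the kernels of $R,R^\pm$ with respect to $\kappa$, i.e. $RY=\kappa_2(R_{12},Y_2)$. $G$ is a Lie group with Lie algebra $\mathfrak{g}$ ($G^{\mathbb{C}}$ its complexification); subscripts $1,2$ are tensor-factor indices in matrix notation. $\delta_{\sigma\sigma'}$ is the Dirac distribution. The path-ordered exponential $T(\sigma,\sigma')=\mathrm{P}\overleftarrow{\exp}(-\int_{\sigma'}^{\sigma}d\rho\,\mathcal{L}(\rho))$ is the solution of $(\partial_\sigma T(\sigma,\sigma'))T(\sigma,\sigma')^{-1}=-\mathcal{L}(\sigma)$, $T(\sigma',\sigma')=1$, and Poisson brackets of $T$ with other observables are computed from the variation formula $\delta T(\sigma,\sigma')=-\int_{\sigma'}^{\sigma}d\rho\,T(\sigma,\rho)\,\delta\mathcal{L}(\rho)\,T(\rho,\sigma')$. $X$ is assumed to decay fast enough for all integrals to converge. (These are the canonical fields $g,X$ of Yang-Baxter type models and the gauge-transformed Lax matrix $\mathcal{L}^g$ evaluated at the two simple poles $\lambda_\pm$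 of the twist function, where it equals $\gamma R^\pm X$.) *)

(* Defs.v *)
From HB Require Import structures.
From mathcomp Require Import all_boot all_order all_algebra.
From mathcomp Require Import complex mxtens.
From mathcomp Require Import all_classical all_reals all_analysis.

Set Implicit Arguments.
Unset Strict Implicit.
Unset Printing Implicit Defensive.

Import Order.TTheory GRing.Theory Num.Theory.
Import numFieldNormedType.Exports.

Local Open Scope classical_set_scope.
Local Open Scope ring_scope.

Section LieAlgebra.
Variables (R : realType) (g : vectType R) (br : g -> g -> g).

Definition is_lie_bracket : Prop :=
  [/\ forall (a : R) x y z, br (a *: x + y) z = a *: br x z + br y z,
      forall (a : R) x y z, br z (a *: x + y) = a *: br z x + br z y,
      forall x, br x x = 0
    & forall x y z, br x (br y z) + br y (br z x) + br z (br x y) = 0].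

Definition lie_ideal (I : {vspace g}) : Prop :=
  forall x y, y \in I -> br x y \in I.

Definition lie_derived (U : {vspace g}) : {vspace g} :=
  <<[seq br x y | x <- vbasis U, y <- vbasis U]>>%VS.

Definition lie_solvable (U : {vspace g}) : Prop :=
  exists n : nat, iter n lie_derived U = 0%VS.

Definition lie_semisimple : Prop :=
  forall I : {vspace g}, lie_ideal I -> lie_solvable I -> I = 0%VS.

Definition vcoord (i : 'I_(\dim {:g})) (x : g) : R := coord (vbasis {:g}) i x.

(* The trace of ad x \o ad y, computed in the basis vbasis {:g}. *)
Definition killing (x y : g) : R :=
  \sum_(i < \dim {:g}) vcoord i (br x (br y (tnth (vbasis {:g}) i))).

(* An element of g (x) g is given by a list of pairs (x_k, y_k), standing for
   the sum of the x_k (x) y_k; everything below is bilinear in (x_k, y_k), so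
   that it depends only on the tensor. *)
Definition tens2 : Type := seq (g * g).

(* A Y = kappa_2 (t_12, Y_2) *)
Definition is_kernel (t : tens2) (A : g -> g) : Prop :=
  forall Y, A Y = \sum_(z <- t) killing z.2 Y *: z.1.

(* kappa_1 kappa_2 (t_12, b_1 b'_2) *)
Definition killing12 (t : tens2) (b b' : g) : R :=
  \sum_(z <- t) killing z.1 b * killing z.2 b'.

(* [t_12, x_2] *)
Definition br2 (t : tens2) (x : g) : tens2 := [seq (z.1, br z.2 x) | z <- t].

Definition killing_skew (A : g -> g) : Prop :=
  forall x y, killing (A x) y = - killing x (A y).

(* c is 1 or i, so that c ^+ 2 is real and the equation holds in g. *)
Definition mCYBE (c : R[i]) (A : g -> g) : Prop :=
  forall x y, br (A x) (A y) - A (br (A x) y + br x (A y))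
              = - complex.Re (c ^+ 2) *: br x y.

(* The complexification of g: the pair (x, y) stands for x + i y. *)
Definition gC : Type := (g * g)%type.

Definition gC_scale (a : R[i]) (x : gC) : gC :=
  (complex.Re a *: x.1 - complex.Im a *: x.2,
   complex.Re a *: x.2 + complex.Im a *: x.1).

Definition gC_add (x y : gC) : gC := (x.1 + y.1, x.2 + y.2).

Definition gC_of (x : g) : gC := (x, 0).

End LieAlgebra.

Section ComplexAnalysis.
Variable R : realType.

Local Notation mu := (@lebesgue_measure R).

Definition Cintegral (f : R -> R[i]) : R[i] :=
  ((\int[mu]_x complex.Re (f x)) +i* (\int[mu]_x complex.Im (f x)))%C.

Variable N : nat.

Definition mx_lim (T : Type) (F : set_system T) (f : T -> 'M[R[i]]_N)
    : 'M[R[i]]_N :=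
  \matrix_(i, j) (lim (complex.Re (f x i j) @[x --> F])
                  +i* lim (complex.Im (f x i j) @[x --> F]))%C.

Definition mx_is_derive (f : R -> 'M[R[i]]_N) (s : R) (D : 'M[R[i]]_N) : Prop :=
  forall i j,
    is_derive s (1 : R) (fun x => complex.Re (f x i j)) (complex.Re (D i j)) /\
    is_derive s (1 : R) (fun x => complex.Im (f x i j)) (complex.Im (D i j)).

Definition mx_continuous (f : R -> 'M[R[i]]_N) : Prop :=
  forall i j, continuous (fun x => complex.Re (f x i j)) /\
              continuous (fun x => complex.Im (f x i j)).

Definition mx_comm (A B : 'M[R[i]]_N) : 'M[R[i]]_N := A *m B - B *m A.

(* T s s' is the path-ordered exponential of - L from s' to s. *)
Definition is_Pexp (L : R -> 'M[R[i]]_N) (T : R -> R -> 'M[R[i]]_N) : Prop :=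
  forall s' : R, T s' s' = 1%:M /\
    forall s : R, T s s' \in unitmx /\
      exists2 D, mx_is_derive (T^~ s') s D & D *m invmx (T s s') = - L s.

(* T(+oo, -oo), T(+oo, r) and T(r, -oo) *)
Definition T_line (T : R -> R -> 'M[R[i]]_N) : 'M[R[i]]_N :=
  mx_lim (filter_prod +oo_R -oo_R) (fun z => T z.1 z.2).

Definition T_to_pinfty (T : R -> R -> 'M[R[i]]_N) (r : R) : 'M[R[i]]_N :=
  mx_lim +oo_R (T^~ r).

Definition T_from_ninfty (T : R -> R -> 'M[R[i]]_N) (r : R) : 'M[R[i]]_N :=
  mx_lim -oo_R (T r).

Definition test_fun (h : R -> R) : Prop :=
  (forall (n : nat) (x : R), derivable (derive1n n h) x 1) /\
  (exists M : R, forall x, M < `|x| -> h x = 0).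

End ComplexAnalysis.

Section Representation.
Variables (R : realType) (g : vectType R) (br : g -> g -> g) (N : nat).
Variable rho : g -> 'M[R[i]]_N.

Definition is_lie_rep : Prop :=
  [/\ forall (a : R) x y, rho (a *: x + y) = (a%:C)%C *: rho x + rho y
    & forall x y, rho (br x y) = mx_comm (rho x) (rho y)].

Definition rhoC (x : gC g) : 'M[R[i]]_N := rho x.1 + ('i)%C *: rho x.2.

Definition rho2 (t : tens2 g) : 'M[R[i]]_(N * N) :=
  \sum_(z <- t) (rho z.1 *t rho z.2).

(* G is a group of matrices whose Lie algebra, i.e. the set of the velocities
   at 1 of the C^1 curves drawn in G, is the image of g. (Every subgroup of
   GL_N(C) is a Lie group with the Lie algebra so defined, closed or not.)
   Taking rho faithful gives the matrix groups with Lie algebra g; in general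
   G is the image of a Lie group with Lie algebra g under a representation with
   differential rho. *)
Definition is_matrix_lie_group (G : set 'M[R[i]]_N) : Prop :=
  [/\ G 1%:M,
      forall A, G A -> A \in unitmx,
      forall A B, G A -> G B -> G (A *m B),
      forall A, G A -> G (invmx A)
    & forall A, (exists x : g, A = rho x) <->
        exists k D : R -> 'M[R[i]]_N,
          [/\ forall t, G (k t), forall t, mx_is_derive k t (D t),
              mx_continuous D, k 0 = 1%:M & D 0 = A]].

End Representation.

(* The two signs are encoded as false for + and true for -. *)
Definition pm (R : realType) (s : bool) (c : R[i]) : R[i] := (-1) ^+ s * c.

(* R^(+-) = R +- c Id, extended C-linearly to the complexification. *)
Definition Rpm (R : realType) (g : vectType R) (Rop : g -> g) (c : R[i])
    (s : bool) (x : gC g) : gC g :=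
  gC_add (Rop x.1, Rop x.2) (gC_scale (pm s c) x).

Section PoissonAlgebra.
Variables (R : realType) (P : Type).
Variables (Obs : set (P -> R[i])) (pb : (P -> R[i]) -> (P -> R[i]) -> P -> R[i]).

(* Obs is a complex Poisson algebra of functions on the phase space P. *)
Record is_poisson_algebra : Prop := {
  obs_cst : forall a : R[i], Obs (fun=> a);
  obs_add : forall E F, Obs E -> Obs F -> Obs (fun p => E p + F p);
  obs_mul : forall E F, Obs E -> Obs F -> Obs (fun p => E p * F p);
  obs_pb : forall E F, Obs E -> Obs F -> Obs (pb E F);
  pb_linear : forall (a : R[i]) E F H, Obs E -> Obs F -> Obs H ->
    forall p, pb (fun q => a * E q + F q) H p = a * pb E H p + pb F H p;
  pb_antisym : forall E F, Obs E -> Obs F -> forall p, pb E F p = - pb F E p;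
  pb_leibniz : forall E F H, Obs E -> Obs F -> Obs H ->
    forall p, pb (fun q => E q * F q) H p = E p * pb F H p + pb E H p * F p;
  pb_jacobi : forall E F H, Obs E -> Obs F -> Obs H ->
    forall p, pb E (pb F H) p + pb F (pb H E) p + pb H (pb E F) p = 0
}.

(* {A_1, B_2}: the coefficient at (ij, kl) is {A_ij, B_kl}. *)
Definition pb12 (N : nat) (A B : P -> 'M[R[i]]_N) (p : P) : 'M[R[i]]_(N * N) :=
  \matrix_(a, b) pb (fun q => A q (mxtens_unindex a).1 (mxtens_unindex b).1)
                    (fun q => B q (mxtens_unindex a).2 (mxtens_unindex b).2) p.

End PoissonAlgebra.

(* A_1 B_2 *)
Definition mul12 (R : realType) (N : nat) (A B : 'M[R[i]]_N)
    : 'M[R[i]]_(N * N) := (A *t 1%:M) *m (1%:M *t B).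

Section Fields.
Variables (R : realType) (g : vectType R) (br : g -> g -> g) (N : nat).
Variables (rho : g -> 'M[R[i]]_N) (P : Type).
Variables (gf : P -> R -> 'M[R[i]]_N) (X : P -> R -> g).

Local Notation mu := (@lebesgue_measure R).
Local Notation kappa := (killing br).

Definition g_test_fun (b : R -> g) : Prop :=
  forall i, test_fun (fun x => vcoord i (b x)).

Definition continuous_integrable (Y : R -> g) : Prop :=
  forall i, continuous (fun x => vcoord i (Y x)) /\
            mu.-integrable setT (fun x => (vcoord i (Y x))%:E).

Definition vanishes_at_infinity (Y : R -> g) : Prop :=
  forall i, (vcoord i (Y x) @[x --> +oo_R] --> 0) /\
            (vcoord i (Y x) @[x --> -oo_R] --> 0).

(* The fields enter the brackets smeared with test functions. *)
Definition X_smeared (b : R -> g) (p : P) : R[i] :=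
  ((\int[mu]_x kappa (b x) (X p x))%:C)%C.

Definition g_smeared (h : R -> R) (i j : 'I_N) (p : P) : R[i] :=
  Cintegral (fun x => (h x)%:C%C * gf p x i j).

Variable pb : (P -> R[i]) -> (P -> R[i]) -> P -> R[i].

(* {g_1(s), g_2(s')} = 0 *)
Definition bracket_gg : Prop :=
  forall h h' i j k l p, test_fun h -> test_fun h' ->
    pb (g_smeared h i j) (g_smeared h' k l) p = 0.

(* {X_1(s), g_2(s')} = g_2(s) C_12 delta(s, s'), tested on b(s) h(s') *)
Definition bracket_Xg (C12 : tens2 g) : Prop :=
  forall b h k l p, g_test_fun b -> test_fun h ->
    pb (X_smeared b) (g_smeared h k l) p =
    Cintegral (fun x => (h x)%:C%C *
      \sum_(z <- C12) (kappa z.1 (b x))%:C%C * (gf p x *m rho z.2) k l).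

(* {X_1(s), X_2(s')} = - [C_12, X_2(s)] delta(s, s'), tested on b(s) b'(s') *)
Definition bracket_XX (C12 : tens2 g) : Prop :=
  forall b b' p, g_test_fun b -> g_test_fun b' ->
    pb (X_smeared b) (X_smeared b') p =
    ((\int[mu]_x (- killing12 br (br2 br C12 (X p x)) (b x) (b' x)))%:C)%C.

(* dX(s) = {X(s), F} at the point p *)
Definition is_X_variation (F : P -> R[i]) (p : P) (dX : R -> gC g) : Prop :=
  [/\ continuous_integrable (fun x => (dX x).1),
      continuous_integrable (fun x => (dX x).2)
    & forall b, g_test_fun b -> pb (X_smeared b) F p =
        Cintegral (fun x => (kappa (b x) (dX x).1 +i* kappa (b x) (dX x).2)%C)].

(* The variation formula on the whole line, for T the path-ordered exponential
   of - L with L(s) = A (X s) and A linear: with d = {., F},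
   dT = - \int T(+oo, r) dL(r) T(r, -oo) dr, where dL(r) = A (dX r). *)
Definition variation_formula (Obs : set (P -> R[i])) (A : gC g -> 'M[R[i]]_N)
    (T : P -> R -> R -> 'M[R[i]]_N) : Prop :=
  forall F p dX, Obs F -> is_X_variation F p dX ->
    forall i j, pb (fun q => T_line (T q) i j) F p =
      - Cintegral (fun r =>
          (T_to_pinfty (T p) r *m A (dX r) *m T_from_ninfty (T p) r) i j).

End Fields.

(* Main.v *)
Require Import Defs.
From HB Require Import structures.
From mathcomp Require Import all_boot all_order all_algebra.
From mathcomp Require Import complex mxtens.
From mathcomp Require Import all_classical all_reals all_analysis.
From mathcomp Require Import perm measurable_realfun ring lra.

Set Implicit Arguments.
Unset Strict Implicit.
Unset Printing Implicit Defensive.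

Import Order.TTheory GRing.Theory Num.Theory.
Import numFieldNormedType.Exports.

Local Open Scope classical_set_scope.
Local Open Scope ring_scope.

(* Write P(r) = T(+oo, r) and Q(r) = T(r, -oo). The variation formula turns the
   bracket with a smeared X into an integral; by antisymmetry this yields the
   variation of X generated by an entry of the monodromy T'(+oo, -oo) at the
   sign s', and a second use of the formula gives
     {T_1, T'_2} = gamma^2 \int P_1 P'_2 (R^s ad_X R^{-s'})_{12} Q_1 Q'_2 dr,
   an operator A standing for its kernel A_{12}.
   By the mCYBE, R^s ad_X R^{-s'} = ad_{R^s X} M - M ad_{R^{s'} X} with M = R if
   s' = s and M = R^s if s' = - s. As P' = P L and Q' = - L Q with
   L = gamma R^s X, the integrand is the derivative of
   gamma P_1 P'_2 M_{12} Q_1 Q'_2, whose boundary values give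
   gamma [M_{12}, T_1 T'_2].
   Existence of P and Q, their boundedness and their limits come from a
   Gronwall estimate, since L is integrable. *)

(** * Integrable continuous functions on the line *)

(** The minus sign in R^{-s'} comes from the Killing form: R being skew, the adjoint of R^{s'} = R +
    c' is -(R - c') = -R^{-s'}, and an operator on the second factor of the Casimir tensor is moved
    to the first one as its adjoint. Write c_s, c_{s'} for the two signed constants and M = R + m.
    After the mCYBE only a multiple of ad_X is left over, with coefficient proportional to m (m -
    c_s) when c_{s'} = c_s - 2 m. The roots m = 0 and m = c_s are the two announced brackets, so one
    computation with a parameter [m] covers both. The weight P ... Q in the first integral need not
    be smooth or compactly supported, so it cannot be treated as a test function. The variation
    formula can still be used a second time because this weight is bounded and X is integrable: the
    variation of X generated by a monodromy entry is [X, W] with W bounded and continuous. Tensors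
    are evaluated on pairs of linear forms; the entries of P rho(x) Q are such forms in x. *)

Section RealLine.
Variable R : realType.
Implicit Types f h F : R -> R.
Local Notation mu := (@lebesgue_measure R).

Definition bcont f : Prop :=
  continuous f /\ exists K, forall x, `|f x| <= K.

(** A module over [bcont]: coefficients will be bounded and Lax matrices integrable. Continuity is
    kept for the fundamental theorem of calculus. *)
Definition cinteg f : Prop :=
  continuous f /\ mu.-integrable setT (EFin \o f).

Lemma bcont_cst a : bcont (cst a).
Proof. by split; [move=> x; exact: cvg_cst|exists `|a|]. Qed.

Lemma bcontD f h : bcont f -> bcont h -> bcont (fun x => f x + h x).
Proof.
move=> [cf [K fK]] [ch [M hM]]; split.
  by move=> x; apply: cvgD; [exact: cf|exact: ch].
by exists (K + M) => x; apply: le_trans (ler_normD _ _) _; apply: lerD.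
Qed.

Lemma bcontM f h : bcont f -> bcont h -> bcont (fun x => f x * h x).
Proof.
move=> [cf [K fK]] [ch [M hM]]; split.
  by move=> x; apply: cvgM; [exact: cf|exact: ch].
by exists (K * M) => x; rewrite normrM ler_pM.
Qed.

Lemma bcontN f : bcont f -> bcont (fun x => - f x).
Proof.
move=> [cf [K fK]]; split; first by move=> x; apply: cvgN; exact: cf.
by exists K => x; rewrite normrN.
Qed.

Lemma cintegD f h : cinteg f -> cinteg h -> cinteg (fun x => f x + h x).
Proof.
move=> [cf fi] [ch hi]; split.
  by move=> x; apply: cvgD; [exact: cf|exact: ch].
by have := integrableD measurableT fi hi.
Qed.

Lemma cintegM f h : bcont f -> cinteg h -> cinteg (fun x => f x * h x).
Proof.
move=> [cf [K fK]] [ch hi]; split.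
  by move=> x; apply: cvgM; [exact: cf|exact: ch].
have mf : measurable_fun setT f by exact: continuous_measurable_fun.
have := @integrableMr _ _ _ mu _ measurableT f _ mf _ hi.
apply; exists K; split; first exact: num_real.
by move=> y /ltW Ky x _ /=; apply: le_trans Ky.
Qed.

Lemma cintegN f : cinteg f -> cinteg (fun x => - f x).
Proof.
move=> fi; rewrite (_ : (fun _ => _) = (fun x => -1 * f x)).
  exact: cintegM (bcont_cst _) fi.
by apply/funext => x; rewrite mulN1r.
Qed.

Lemma cinteg0 : cinteg (cst 0).
Proof.
split; first by move=> x; exact: cvg_cst.
exact: (@integrable0 _ _ _ mu setT).
Qed.

Lemma cinteg_norm f : cinteg f -> cinteg (fun x => `|f x|).
Proof.
move=> [cf fi]; split; first by move=> x; apply: cvg_norm; exact: cf.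
exact: integrable_norm.
Qed.

Definition prim f x := \int[mu]_(t in `]-oo, x]) f t.

Lemma primE f x : prim f x = \int[mu]_t (f \_ `]-oo, x]) t.
Proof. by rewrite /prim Rintegral_mkcond. Qed.

(** Dominated convergence with bound |f|: at each point the restrictions of f to the [A n] are
    eventually constant in n. *)
Lemma cvg_integral_patch f (A : (set R)^nat) (B : set R) :
  mu.-integrable setT (EFin \o f) ->
  (forall n, measurable (A n)) -> measurable B ->
  (forall x, \forall n \near \oo, A n x <-> B x) ->
  (\int[mu]_t (f \_ (A n)) t) @[n --> \oo] --> \int[mu]_t (f \_ B) t.
Proof.
move=> fi mA mB AB.
have mf : measurable_fun setT f by move/integrableP : fi => [/measurable_EFinP].
have mp C : measurable C -> measurable_fun setT (EFin \o (f \_ C)).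
  move=> mC; apply/measurable_EFinP.
  by apply/(measurable_restrictT _ _).1 => //; exact: measurable_funTS.
have le C x : (`|(EFin \o (f \_ C)) x| <= (EFin \o (Num.norm \o f)) x)%E.
  rewrite /= lee_fin patchE; case: ifP => // _.
  by rewrite normr0.
have fB x : setT x -> (EFin \o (f \_ (A n))) x @[n --> \oo] --> (EFin \o (f \_ B)) x.
  move=> _; apply: cvg_near_cst; apply: filterS (AB x) => n An /=.
  rewrite !patchE; congr (if _ then _ else _)%:E.
  by apply/idP/idP; rewrite !inE => /An.
have [|||||iB _] := @dominated_convergence _ _ R mu setT measurableT
   (fun n => EFin \o (f \_ (A n))) (EFin \o (f \_ B)) (EFin \o (Num.norm \o f)).
- by move=> n; exact: mp.
- exact: mp.
- exact: aeW.
- exact: integrable_norm.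
- by apply: aeW => x n _; exact: le.
have Bfin := integrable_fin_num measurableT iB.
move=> h; apply: fine_cvg; rewrite fineK//; exact: h.
Qed.

Lemma prim_cvgy f : cinteg f -> prim f x @[x --> +oo] --> \int[mu]_t f t.
Proof.
(* The limit is tested on sequences, since dominated convergence concerns sequences. *)
move=> [_ fi]; apply/cvg_pinftyP => u uy.
have -> : \int[mu]_t f t = \int[mu]_t (f \_ setT) t.
  by apply: eq_Rintegral => x _; rewrite patch_setT.
under eq_fun do rewrite primE.
apply: cvg_integral_patch => // x.
move/cvgryPge : uy => /(_ x); apply: filterS => n xu.
by rewrite set_itvNyc/=; split.
Qed.

Lemma prim_cvgNy f : cinteg f -> prim f x @[x --> -oo] --> 0.
Proof.
move=> [_ fi]; apply/cvg_ninftyP => u uy.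
have -> : 0 = \int[mu]_t (f \_ set0) t.
  by rewrite -Rintegral_mkcond Rintegral_set0.
under eq_fun do rewrite primE.
apply: cvg_integral_patch => // x.
move/cvgrNyPlt : uy => /(_ x); apply: filterS => n xu.
rewrite set_itvNyc/=; split => //; by rewrite leNgt xu.
Qed.

Lemma is_derive_prim f x : cinteg f -> is_derive x (1 : R) (prim f) (f x).
Proof.
move=> [cf fi].
have xx1 : x < x + 1 by rewrite ltrDl.
have fx1 : mu.-integrable `]-oo, x + 1] (EFin \o f) by apply: integrableS fi.
have [d e] := continuous_FTC1 xx1 fx1 (ltNyr _) (cf x).
by split; [exact: d|rewrite -derive1E].
Qed.

Lemma prim_bound f x : cinteg f -> `|prim f x| <= \int[mu]_t `|f t|.
Proof.
move=> [cf fi].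
have fx : mu.-integrable `]-oo, x] (EFin \o f) by apply: integrableS fi.
apply: le_trans (le_normr_Rintegral _ fx) _ => //.
have nfi := integrable_norm fi.
apply: fine_le.
- exact: integrable_fin_num (integrable_norm fx).
- exact: integrable_fin_num nfi.
- by apply: ge0_subset_integral => //; move/integrableP : nfi => [mnf _]; apply: mnf.
Qed.

Lemma is_derive_cst_eq f h x y :
  (forall z, exists2 d, is_derive z (1 : R) f d & is_derive z (1 : R) h d) ->
  f x - h x = f y - h y.
Proof.
move=> H; apply: (@is_derive_0_is_cst _ (f - h)) => z.
have [d df dh] := H z; rewrite -(subrr d); exact: is_deriveB.
Qed.

(** F and [prim f] have the same derivative, so they differ by a constant, the limit at -oo. This
    serves both to give solutions limits at infinity and to evaluate the bracket by boundary
    values. *)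
Lemma FTC_line F f : (forall x, is_derive x (1 : R) F (f x)) -> cinteg f ->
  exists l, [/\ F x @[x --> -oo] --> l &
     F x @[x --> +oo] --> l + \int[mu]_t f t].
Proof.
move=> dF fi.
have [c ->] : exists c, F = (fun x => c + prim f x).
  exists (F 0 - prim f 0); apply/funext => x; apply/eqP; rewrite -subr_eq.
  apply/eqP.
  by apply: is_derive_cst_eq => z; exists (f z) => //; exact: is_derive_prim.
exists c.
split; last exact: (cvgD (cvg_cst c) (prim_cvgy fi)).
rewrite -[X in _ --> X]addr0.
exact: (cvgD (cvg_cst c) (prim_cvgNy fi)).
Qed.

Lemma monotone_deriv f d : (forall x, is_derive x (1 : R) f (d x)) ->
  (forall x, 0 <= d x) -> {homo f : x y / x <= y}.
Proof.
move=> df d0 x y xy.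
have cf : {within `[x, y], continuous f}.
  by apply: derivable_within_continuous => z _; have [] := df z.
have := @ger0_derive1_le_cc _ f x y _ _ cf.
apply => //.
- by move=> z _; rewrite derive1E; have [_ ->] := df z.
- by rewrite in_itv/= lexx.
- by rewrite in_itv/= lexx xy.
Qed.

(* Multiplying by exp (-+ prim l) makes n monotone on either side of y. *)
Lemma gronwall (n d l : R -> R) : (forall x, is_derive x (1 : R) n (d x)) ->
  (forall x, 0 <= n x) -> cinteg l -> (forall x, `|d x| <= l x * n x) ->
  forall x y, n x <= n y * expR (\int[mu]_t `|l t| + \int[mu]_t `|l t|).
Proof.
move=> dn n0 li dl x y; set I := \int[mu]_t `|l t|.
have dE (a : R) z : is_derive z (1 : R) (fun t => n t * expR (a * prim l t))
    ((d z + a * l z * n z) * expR (a * prim l z)).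
  have dp := is_derive_prim z li.
  have da : is_derive z (1 : R) (a \*: prim l) (a *: l z) by exact: is_deriveZ.
  have de : is_derive z (1 : R) (expR \o (a \*: prim l))
      (expR (a * prim l z) *: (a *: l z)).
    exact: is_derive1_comp.
  apply: is_derive_eq (is_deriveM (dn z) de) _.
  by rewrite /= /GRing.scale /=; ring.
(* Between two points [prim l] varies by at most 2 I, whence the sum of two integrals in the
   exponent. *)
have pb z : - I <= prim l z <= I by rewrite -ler_norml; exact: prim_bound.
have [xy|yx] := leP x y.
- have M : n x * expR (1 * prim l x) <= n y * expR (1 * prim l y).
    apply: (monotone_deriv (dE 1) _ xy) => z.
    rewrite mulr_ge0// ?expR_ge0//; have := dl z; rewrite ler_norml mul1r.
    by move=> /andP[+ _]; rewrite -subr_ge0 opprK addrC.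
  rewrite !mul1r in M.
  have -> : n x = n x * expR (prim l x) * expR (- prim l x).
    by rewrite -mulrA -expRD subrr expR0 mulr1.
  apply: le_trans (ler_wpM2r (expR_ge0 _) M) _.
  rewrite -mulrA -expRD ler_wpM2l// ler_expR.
  by have := pb x; have := pb y; lra.
- have M : - (n y * expR (- 1 * prim l y)) <= - (n x * expR (- 1 * prim l x)).
    apply: (monotone_deriv (fun z => is_deriveN (dE (- 1) z)) _ (ltW yx)) => z.
    rewrite -mulNr mulr_ge0// ?expR_ge0//; have := dl z; rewrite ler_norml.
    by move=> /andP[_]; lra.
  rewrite lerN2 !mulN1r in M.
  have -> : n x = n x * expR (- prim l x) * expR (prim l x).
    by rewrite -mulrA -expRD addNr expR0 mulr1.
  apply: le_trans (ler_wpM2r (expR_ge0 _) M) _.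
  rewrite -mulrA -expRD ler_wpM2l// ler_expR.
  by have := pb x; have := pb y; lra.
Qed.

End RealLine.

(** * Complex-valued functions *)

Section ComplexCalculus.
Variable R : realType.
Implicit Types (f h : R -> R[i]) (s : R).

Lemma cReM (x y : R[i]) : complex.Re (x * y) =
  complex.Re x * complex.Re y - complex.Im x * complex.Im y.
Proof. by case: x y => [a b] [u v]. Qed.

Lemma cImM (x y : R[i]) : complex.Im (x * y) =
  complex.Re x * complex.Im y + complex.Im x * complex.Re y.
Proof. by case: x y => [a b] [u v]. Qed.

Lemma cReD (x y : R[i]) : complex.Re (x + y) = complex.Re x + complex.Re y.
Proof. by case: x y => [a b] [u v]. Qed.

Lemma cImD (x y : R[i]) : complex.Im (x + y) = complex.Im x + complex.Im y.
Proof. by case: x y => [a b] [u v]. Qed.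

Lemma Re_sum (I : Type) (r : seq I) (u : I -> R[i]) :
  complex.Re (\sum_(i <- r) u i) = \sum_(i <- r) complex.Re (u i).
Proof. by apply: (big_morph _ cReD). Qed.

Lemma Im_sum (I : Type) (r : seq I) (u : I -> R[i]) :
  complex.Im (\sum_(i <- r) u i) = \sum_(i <- r) complex.Im (u i).
Proof. by apply: (big_morph _ cImD). Qed.

Lemma eq_ReIm (x y : R[i]) :
  complex.Re x = complex.Re y -> complex.Im x = complex.Im y -> x = y.
Proof. by case: x y => [a b] [u v] /= -> ->. Qed.

(** Derivatives, limits and integrability are taken on real and imaginary parts, in agreement with
    [mx_is_derive], [mx_lim] and [Cintegral]. *)
Definition cderive f s (d : R[i]) : Prop :=
  is_derive s (1 : R) (fun x => complex.Re (f x)) (complex.Re d) /\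
  is_derive s (1 : R) (fun x => complex.Im (f x)) (complex.Im d).

Lemma cderive_cst (a : R[i]) s : cderive (fun=> a) s 0.
Proof. by split; exact: is_derive_cst. Qed.

Lemma cderiveD f h s d e :
  cderive f s d -> cderive h s e -> cderive (fun x => f x + h x) s (d + e).
Proof.
move=> [f1 f2] [h1 h2]; split; rewrite ?cReD ?cImD.
  by under eq_fun do rewrite cReD; exact: is_deriveD.
by under eq_fun do rewrite cImD; exact: is_deriveD.
Qed.

Lemma cderiveM f h s d e : cderive f s d -> cderive h s e ->
  cderive (fun x => f x * h x) s (d * h s + f s * e).
Proof.
move=> [f1 f2] [h1 h2]; split; rewrite ?cReD ?cImD ?cReM ?cImM.
  under eq_fun do rewrite cReM.
  apply: is_derive_eq (is_deriveB (is_deriveM f1 h1) (is_deriveM f2 h2)) _.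
  by rewrite /GRing.scale /=; ring.
under eq_fun do rewrite cImM.
apply: is_derive_eq (is_deriveD (is_deriveM f1 h2) (is_deriveM f2 h1)) _.
by rewrite /GRing.scale /=; ring.
Qed.

Lemma cderiveZ (a : R[i]) f s d : cderive f s d -> cderive (fun x => a * f x) s (a * d).
Proof.
by move=> df; have := cderiveM (cderive_cst a s) df; rewrite mul0r add0r.
Qed.

Lemma cderive_sum (I : Type) (r : seq I) (f : I -> R -> R[i]) s (d : I -> R[i]) :
  (forall i, cderive (f i) s (d i)) ->
  cderive (fun x => \sum_(i <- r) f i x) s (\sum_(i <- r) d i).
Proof.
move=> df; elim: r => [|i r IH].
  rewrite big_nil (_ : (fun _ => _) = fun=> 0); first exact: cderive_cst.
  by apply/funext => x; rewrite big_nil.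
rewrite big_cons (_ : (fun _ => _) = fun x => f i x + \sum_(j <- r) f j x).
  exact: cderiveD.
by apply/funext => x; rewrite big_cons.
Qed.

Lemma cderive_prod (I : Type) (r : seq I) (f : I -> R -> R[i]) s :
  (forall i, exists d, cderive (f i) s d) ->
  exists d, cderive (fun x => \prod_(i <- r) f i x) s d.
Proof.
move=> df; elim: r => [|i r [d IH]].
  exists 0; rewrite (_ : (fun _ => _) = fun=> 1); first exact: cderive_cst.
  by apply/funext => x; rewrite big_nil.
have [e fe] := df i; exists (e * (\prod_(j <- r) f j s) + f i s * d).
rewrite (_ : (fun _ => _) = fun x => f i x * \prod_(j <- r) f j x).
  exact: cderiveM.
by apply/funext => x; rewrite big_cons.
Qed.

Lemma cderiveV f s d : f s != 0 -> cderive f s d ->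
  exists e, cderive (fun x => (f x)^-1) s e.
Proof.
move=> fs [f1 f2].
(* n is |f|^2, and 1/f = (Re f - i Im f) / n. *)
pose n x := complex.Re (f x) ^+ 2 + complex.Im (f x) ^+ 2.
have ns : n s != 0.
  apply: contra fs; rewrite /n paddr_eq0 ?sqr_ge0// !sqrf_eq0 => /andP[/eqP a /eqP b].
  by apply/eqP/eq_ReIm.
have dn := is_deriveD (is_deriveM f1 f1) (is_deriveM f2 f2).
have nE : (fun x => complex.Re (f x)) * (fun x => complex.Re (f x)) +
          (fun x => complex.Im (f x)) * (fun x => complex.Im (f x)) = n.
  by apply/funext => x; rewrite /n !expr2.
rewrite nE in dn.
have dV := is_deriveV ns dn.
have dr := is_deriveM f1 dV.
have di := is_deriveN (is_deriveM f2 dV).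
have Vn : (fun x => (f x)^-1) = (fun x =>
    complex.Complex (complex.Re (f x) * (n x)^-1) (- (complex.Im (f x) * (n x)^-1))).
  by apply/funext => x; rewrite /n; case: (f x).
by eexists (complex.Complex _ _); rewrite Vn; split; [exact: dr|exact: di].
Qed.

Section Limits.
Variables (T : Type) (F : set_system T).
Context {FF : Filter F}.
Implicit Types (u v : T -> R[i]).

Definition ccvg u (l : R[i]) : Prop :=
  (complex.Re (u x) @[x --> F] --> complex.Re l) /\
  (complex.Im (u x) @[x --> F] --> complex.Im l).

Lemma ccvg_cst (a : R[i]) : ccvg (fun=> a) a.
Proof. by split; exact: cvg_cst. Qed.

Lemma ccvgD u v k l : ccvg u k -> ccvg v l -> ccvg (fun x => u x + v x) (k + l).
Proof.
move=> [u1 u2] [v1 v2]; split; rewrite ?cReD ?cImD.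
  by under eq_fun do rewrite cReD; exact: cvgD.
by under eq_fun do rewrite cImD; exact: cvgD.
Qed.

Lemma ccvgM u v k l : ccvg u k -> ccvg v l -> ccvg (fun x => u x * v x) (k * l).
Proof.
move=> [u1 u2] [v1 v2]; split; rewrite ?cReM ?cImM.
  by under eq_fun do rewrite cReM; apply: cvgB; exact: cvgM.
by under eq_fun do rewrite cImM; apply: cvgD; exact: cvgM.
Qed.

Lemma ccvg_sum (I : Type) (r : seq I) (f : I -> T -> R[i]) (d : I -> R[i]) :
  (forall i, ccvg (f i) (d i)) ->
  ccvg (fun x => \sum_(i <- r) f i x) (\sum_(i <- r) d i).
Proof.
move=> df; elim: r => [|i r IH].
  rewrite big_nil (_ : (fun _ => _) = fun=> 0); first exact: ccvg_cst.
  by apply/funext => x; rewrite big_nil.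
rewrite big_cons (_ : (fun _ => _) = fun x => f i x + \sum_(j <- r) f j x).
  exact: ccvgD.
by apply/funext => x; rewrite big_cons.
Qed.

End Limits.

Lemma ccvg_unique (T : Type) (F : set_system T) {FF : ProperFilter F}
  (u : T -> R[i]) k l : ccvg F u k -> ccvg F u l -> k = l.
Proof.
by move=> [u1 u2] [v1 v2]; apply: eq_ReIm;
  [apply: cvg_unique u1 v1|apply: cvg_unique u2 v2].
Qed.

Definition cbc f : Prop :=
  bcont (fun x => complex.Re (f x)) /\ bcont (fun x => complex.Im (f x)).

Definition cci f : Prop :=
  cinteg (fun x => complex.Re (f x)) /\ cinteg (fun x => complex.Im (f x)).

Lemma cbc_cst (a : R[i]) : cbc (fun=> a).
Proof. by split; exact: bcont_cst. Qed.

Lemma cbcD f h : cbc f -> cbc h -> cbc (fun x => f x + h x).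
Proof.
move=> [f1 f2] [h1 h2]; split.
  by under eq_fun do rewrite cReD; exact: bcontD.
by under eq_fun do rewrite cImD; exact: bcontD.
Qed.

Lemma cbcM f h : cbc f -> cbc h -> cbc (fun x => f x * h x).
Proof.
move=> [f1 f2] [h1 h2]; split.
  under eq_fun do rewrite cReM.
  by apply: bcontD; [exact: bcontM|apply: bcontN; exact: bcontM].
by under eq_fun do rewrite cImM; apply: bcontD; exact: bcontM.
Qed.

Lemma cbc_sum (I : Type) (r : seq I) (f : I -> R -> R[i]) :
  (forall i, cbc (f i)) -> cbc (fun x => \sum_(i <- r) f i x).
Proof.
move=> df; elim: r => [|i r IH].
  rewrite (_ : (fun _ => _) = fun=> 0); first exact: cbc_cst.
  by apply/funext => x; rewrite big_nil.
rewrite (_ : (fun _ => _) = fun x => f i x + \sum_(j <- r) f j x).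
  exact: cbcD.
by apply/funext => x; rewrite big_cons.
Qed.

Lemma cciD f h : cci f -> cci h -> cci (fun x => f x + h x).
Proof.
move=> [f1 f2] [h1 h2]; split.
  by under eq_fun do rewrite cReD; exact: cintegD.
by under eq_fun do rewrite cImD; exact: cintegD.
Qed.

Lemma cciM f h : cbc f -> cci h -> cci (fun x => f x * h x).
Proof.
move=> [f1 f2] [h1 h2]; split.
  under eq_fun do rewrite cReM.
  by apply: cintegD; [exact: cintegM|apply: cintegN; exact: cintegM].
by under eq_fun do rewrite cImM; apply: cintegD; exact: cintegM.
Qed.

Lemma cci0 : cci (fun=> 0).
Proof. by split; exact: cinteg0. Qed.

Lemma cci_sum (I : Type) (r : seq I) (f : I -> R -> R[i]) :
  (forall i, cci (f i)) -> cci (fun x => \sum_(i <- r) f i x).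
Proof.
move=> df; elim: r => [|i r IH].
  rewrite (_ : (fun _ => _) = fun=> 0); first exact: cci0.
  by apply/funext => x; rewrite big_nil.
rewrite (_ : (fun _ => _) = fun x => f i x + \sum_(j <- r) f j x).
  exact: cciD.
by apply/funext => x; rewrite big_cons.
Qed.

Lemma cFTC_line f h : (forall x, cderive f x (h x)) -> cci h ->
  exists l, ccvg -oo_R f l /\ ccvg +oo_R f (l + Cintegral h).
Proof.
move=> df [h1 h2].
have [a [a1 a2]] := FTC_line (fun x => (df x).1) h1.
have [b [b1 b2]] := FTC_line (fun x => (df x).2) h2.
by exists (complex.Complex a b).
Qed.

End ComplexCalculus.

(** * Linear matrix differential equations *)

Section MatrixODE.
Variables (R : realType) (N : nat).
Local Notation mx := ('M[R[i]]_N).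
Implicit Types (A B Y Z L : R -> mx) (a : mx).

Definition mxcvg (T : Type) (F : set_system T) (A : T -> mx) (l : mx) : Prop :=
  forall i j, ccvg F (fun x => A x i j) (l i j).
Definition mxbc A : Prop := forall i j, cbc (fun x => A x i j).
Definition mxci A : Prop := forall i j, cci (fun x => A x i j).

Lemma mxcvg_cst (T : Type) (F : set_system T) {FF : Filter F} a :
  mxcvg F (fun=> a) a.
Proof. by move=> i j; exact: ccvg_cst. Qed.

Lemma mxcvgM (T : Type) (F : set_system T) {FF : Filter F} (A B : T -> mx) k l :
  mxcvg F A k -> mxcvg F B l -> mxcvg F (fun x => A x *m B x) (k *m l).
Proof.
move=> hA hB i j; rewrite mxE; under eq_fun do rewrite mxE.
by apply: ccvg_sum => m; exact: ccvgM.
Qed.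

Lemma mxcvg_unique (T : Type) (F : set_system T) {FF : ProperFilter F}
  (A : T -> mx) k l : mxcvg F A k -> mxcvg F A l -> k = l.
Proof. by move=> h1 h2; apply/matrixP => i j; exact: ccvg_unique (h1 i j) (h2 i j). Qed.

Lemma mx_limE (T : Type) (F : set_system T) {FF : ProperFilter F}
  (A : T -> mx) l : mxcvg F A l -> mx_lim F A = l.
Proof.
move=> hA; apply/matrixP => i j; rewrite mxE; have [h1 h2] := hA i j.
by apply: eq_ReIm => /=; apply: cvg_lim.
Qed.

Lemma mxbcM A B : mxbc A -> mxbc B -> mxbc (fun x => A x *m B x).
Proof.
move=> hA hB i j; under eq_fun do rewrite mxE.
by apply: cbc_sum => m; exact: cbcM.
Qed.

Lemma mxbc_cst a : mxbc (fun=> a).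
Proof. by move=> i j; exact: cbc_cst. Qed.

Lemma mxciMr A B : mxbc A -> mxci B -> mxci (fun x => A x *m B x).
Proof.
move=> hA hB i j; under eq_fun do rewrite mxE.
by apply: cci_sum => m; exact: cciM.
Qed.

Lemma mxciMl A B : mxci A -> mxbc B -> mxci (fun x => A x *m B x).
Proof.
move=> hA hB i j; under eq_fun do rewrite mxE.
by apply: cci_sum => m; under eq_fun do rewrite mulrC; exact: cciM.
Qed.

Lemma mxciN A : mxci A -> mxci (fun x => - A x).
Proof.
move=> hA i j; rewrite (_ : (fun _ => _) = fun x => -1 * A x i j).
  by apply: cciM => //; exact: cbc_cst.
by apply/funext => x; rewrite mxE mulN1r.
Qed.

Lemma mx_is_derive_cst a s : mx_is_derive (fun=> a : mx) s 0.
Proof. by move=> i j; rewrite mxE; exact: cderive_cst. Qed.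

Lemma mx_is_deriveD A B s C D : mx_is_derive A s C -> mx_is_derive B s D ->
  mx_is_derive (fun x => A x + B x) s (C + D).
Proof.
move=> hA hB i j; rewrite mxE.
rewrite (_ : (fun x => complex.Re _) =
    fun x => complex.Re (A x i j + B x i j)); last first.
  by apply/funext => x; rewrite mxE.
rewrite (_ : (fun x => complex.Im _) =
    fun x => complex.Im (A x i j + B x i j)); last first.
  by apply/funext => x; rewrite mxE.
exact: (cderiveD (hA i j) (hB i j)).
Qed.

Lemma mx_is_deriveM A B s C D : mx_is_derive A s C -> mx_is_derive B s D ->
  mx_is_derive (fun x => A x *m B x) s (C *m B s + A s *m D).
Proof.
move=> hA hB i j; rewrite !mxE -big_split /=.
rewrite (_ : (fun x => complex.Re _) =
    fun x => complex.Re (\sum_k A x i k * B x k j)); last first.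
  by apply/funext => x; rewrite mxE.
rewrite (_ : (fun x => complex.Im _) =
    fun x => complex.Im (\sum_k A x i k * B x k j)); last first.
  by apply/funext => x; rewrite mxE.
apply: (@cderive_sum _ _ _ (fun k x => A x i k * B x k j)) => k.
exact: cderiveM (hA i k) (hB k j).
Qed.

Lemma mx_is_derive_unique A s C D :
  mx_is_derive A s C -> mx_is_derive A s D -> C = D.
Proof.
move=> hC hD; apply/matrixP => i j; have [c1 c2] := hC i j; have [d1 d2] := hD i j.
by apply: eq_ReIm; [have [_ <-] := c1; have [_ <-] := d1|
                    have [_ <-] := c2; have [_ <-] := d2].
Qed.

Lemma mx_is_derive_tr A s C : mx_is_derive A s C ->
  mx_is_derive (fun x => (A x)^T) s C^T.
Proof.
move=> hA i j; rewrite mxE; have := hA j i.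
rewrite (_ : (fun x => complex.Re ((A x)^T i j)) = fun x => complex.Re (A x j i)).
  rewrite (_ : (fun x => complex.Im ((A x)^T i j)) = fun x => complex.Im (A x j i)) //.
  by apply/funext => x; rewrite mxE.
by apply/funext => x; rewrite mxE.
Qed.

Lemma derivable_det n (A : R -> 'M[R[i]]_n) s :
  (forall i j, exists d, cderive (fun x => A x i j) s d) ->
  exists d, cderive (fun x => \det (A x)) s d.
Proof.
move=> hA.
have H (t : 'S_n) : exists d,
    cderive (fun x => (-1) ^+ t * \prod_i A x i (t i)) s d.
  have [d hd] := cderive_prod (index_enum _) (fun i => hA i (t i)).
  by eexists; exact: cderiveZ hd.
have [d hd] := choice H.
by eexists; exact: cderive_sum hd.
Qed.

(** Cramer's rule. Mere existence of the derivative is enough: its value is found later by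
    differentiating A^{-1} A = 1. *)
Lemma derivable_invmx A s :
  (forall x, A x \in unitmx) ->
  (exists D, mx_is_derive A s D) ->
  exists D, mx_is_derive (fun x => invmx (A x)) s D.
Proof.
move=> Au [D hD].
have dA i j : exists d, cderive (fun x => A x i j) s d by exists (D i j); exact: hD.
have [d dd] := derivable_det dA.
have [e de] : exists e, cderive (fun x => (\det (A x))^-1) s e.
  by apply: cderiveV dd; rewrite -unitfE -unitmxE Au.
have H i j : exists c, cderive (fun x => invmx (A x) i j) s c.
  have [c hc] : exists c, cderive (fun x => cofactor (A x) j i) s c.
    have [|c hc] := @derivable_det _ (fun x => row' j (col' i (A x))) s.
      move=> k l; have [a ha] := dA (lift j k) (lift i l); exists a.
      rewrite (_ : (fun _ => _) = fun x => A x (lift j k) (lift i l)) //.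
      by apply/funext => x; rewrite !mxE.
    by eexists; exact: cderiveZ hc.
  exists (e * cofactor (A s) j i + (\det (A s))^-1 * c).
  rewrite (_ : (fun x => _) = fun x => (\det (A x))^-1 * cofactor (A x) j i).
    exact: cderiveM.
  by apply/funext => x; rewrite /invmx Au !mxE.
have [E hE] := choice (fun ij => H ij.1 ij.2).
by exists (\matrix_(i, j) E (i, j)) => i j; rewrite mxE; exact: (hE (i, j)).
Qed.


(** The squared Frobenius norm, which unlike the norm is differentiable at 0 too. *)
Definition mxnorm2 (a : mx) : R :=
  \sum_i \sum_j (complex.Re (a i j) ^+ 2 + complex.Im (a i j) ^+ 2).

Lemma mxnorm2_ge0 a : 0 <= mxnorm2 a.
Proof. by apply: sumr_ge0 => i _; apply: sumr_ge0 => j _; rewrite addr_ge0// sqr_ge0. Qed.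

Lemma mxnorm2_entry a i j :
  complex.Re (a i j) ^+ 2 + complex.Im (a i j) ^+ 2 <= mxnorm2 a.
Proof.
rewrite /mxnorm2 (bigD1 i)//= (bigD1 j)//= -addrA lerDl addr_ge0//.
  by apply: sumr_ge0 => k _; rewrite addr_ge0// sqr_ge0.
by apply: sumr_ge0 => k _; apply: sumr_ge0 => l _; rewrite addr_ge0// sqr_ge0.
Qed.

Lemma mxnorm20 : mxnorm2 0 = 0.
Proof.
rewrite /mxnorm2 big1// => i _; rewrite big1// => j _.
by rewrite mxE /= expr0n addr0.
Qed.

Lemma mxnorm2_eq0 a : mxnorm2 a <= 0 -> a = 0.
Proof.
move=> a0; apply/matrixP => i j; rewrite mxE.
have := le_trans (mxnorm2_entry a i j) a0.
move=> h; have {h} : complex.Re (a i j) ^+ 2 + complex.Im (a i j) ^+ 2 == 0.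
  by rewrite eq_le h addr_ge0// sqr_ge0.
rewrite paddr_eq0 ?sqr_ge0// !sqrf_eq0 => /andP[/eqP h1 /eqP h2].
exact: eq_ReIm.
Qed.

(** The quantity bounded is Re (conj(y) l z). Grouped by Re l and Im l, each coefficient is at most
    (|y|^2 + |z|^2) / 2 <= n. *)
Lemma ReIm_mul_bound (y l z : R[i]) (n : R) :
  complex.Re y ^+ 2 + complex.Im y ^+ 2 <= n ->
  complex.Re z ^+ 2 + complex.Im z ^+ 2 <= n ->
  `|complex.Re y * complex.Re (l * z) + complex.Im y * complex.Im (l * z)|
    <= (`|complex.Re l| + `|complex.Im l|) * n.
Proof.
case: y l z => [a b] [p q] [u v] /= h1 h2.
have -> : a * (p * u - q * v) + b * (p * v + q * u) =
  p * (a * u + b * v) + q * (b * u - a * v) by ring.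
apply: le_trans (ler_normD _ _) _; rewrite !normrM mulrDl.
by apply: lerD; apply: ler_wpM2l => //; rewrite ler_norml; apply/andP; split;
  have := (sqr_ge0 (a - u), sqr_ge0 (a + u), sqr_ge0 (b - v), sqr_ge0 (b + v));
  have := (sqr_ge0 (a - v), sqr_ge0 (a + v), sqr_ge0 (b - u), sqr_ge0 (b + u));
  move=> [[[? ?] ?] ?] [[[? ?] ?] ?]; nra.
Qed.

Lemma mx_gronwall L : mxci L -> exists K, forall Y,
  (forall s, mx_is_derive Y s (- L s *m Y s)) ->
  forall x y, mxnorm2 (Y x) <= mxnorm2 (Y y) * K.
Proof.
move=> Li.
(* Each product of two entries of Y is bounded by the whole [mxnorm2], so every pair (i, j)
   contributes the full row i of L; the factor 2 comes from differentiating squares. *)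
pose l s := \sum_(ij : 'I_N * 'I_N) \sum_k
  2 * (`|complex.Re ((- L s) ij.1 k)| + `|complex.Im ((- L s) ij.1 k)|).
have li : cinteg l.
  pose l' ij k s : R[i] := complex.Complex
    (2 * (`|complex.Re ((- L s) (ij : 'I_N * 'I_N).1 k)| +
     `|complex.Im ((- L s) ij.1 k)|)) 0.
  have : cci (fun s => \sum_ij \sum_k l' ij k s).
    apply: cci_sum => ij; apply: cci_sum => k.
    have [h1 h2] := mxciN Li ij.1 k.
    split; last exact: cinteg0.
    apply: cintegM; first exact: bcont_cst.
    by apply: cintegD; exact: cinteg_norm.
  case; rewrite (_ : (fun _ => _) = l) //; apply/funext => s.
  rewrite Re_sum /l; apply: eq_bigr => ij _.
  by rewrite Re_sum.
exists (expR (\int[@lebesgue_measure R]_t `|l t| + \int[@lebesgue_measure R]_t `|l t|)).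
move=> Y dY x y.
pose D s := - L s *m Y s.
apply: (@gronwall _ (fun s => mxnorm2 (Y s)) (fun s => \sum_i \sum_j
   2 * (complex.Re (Y s i j) * complex.Re (D s i j)
    + complex.Im (Y s i j) * complex.Im (D s i j))) l) => //.
- move=> s.
  have dij i j : cderive (fun x => (complex.Re (Y x i j) ^+ 2
       + complex.Im (Y x i j) ^+ 2)%:C%C) s
      (2 * (complex.Re (Y s i j) * complex.Re (D s i j)
    + complex.Im (Y s i j) * complex.Im (D s i j)))%:C%C.
    have [h1 h2] := dY s i j.
    split; last exact: is_derive_cst.
    have := is_deriveD (is_deriveM h1 h1) (is_deriveM h2 h2).
    rewrite (_ : _ * _ + _ * _ = fun x => complex.Re (Y x i j) ^+ 2
       + complex.Im (Y x i j) ^+ 2); last by apply/funext => z; rewrite !expr2.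
    by move=> h; apply: is_derive_eq h _; rewrite /GRing.scale /=; ring.
  have := cderive_sum (index_enum _) (fun i => cderive_sum (index_enum _) (dij i)).
  have E (F : 'I_N -> 'I_N -> R) : complex.Re (\sum_i \sum_j ((F i j)%:C)%C) =
      \sum_i \sum_j F i j.
    rewrite Re_sum; apply: eq_bigr => i _.
    by rewrite Re_sum.
  case=> h _; move: h; rewrite E.
  rewrite (_ : (fun _ => _) = (fun s => mxnorm2 (Y s))) //.
  by apply/funext => z; rewrite E.
- by move=> s; exact: mxnorm2_ge0.
- move=> s; rewrite /l mulr_suml -(pair_bigA _ (fun i j => (\sum_k 2 *
      (`|complex.Re ((- L s) i k)| + `|complex.Im ((- L s) i k)|))
      * mxnorm2 (Y s))) /=.
  apply: le_trans (ler_norm_sum _ _ _) _; apply: ler_sum => i _.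
  apply: le_trans (ler_norm_sum _ _ _) _; apply: ler_sum => j _.
  rewrite /D mxE !Re_sum !Im_sum.
  rewrite mulr_suml !mulr_sumr -big_split /= mulr_sumr.
  apply: le_trans (ler_norm_sum _ _ _) _; apply: ler_sum => k _.
  rewrite normrM ger0_norm// -mulrA ler_wpM2l//.
  by apply: ReIm_mul_bound; exact: mxnorm2_entry.
Qed.

End MatrixODE.

(** * Path-ordered exponentials on the whole line *)

Section PathOrdered.
Variables (R : realType) (N : nat).
Local Notation mx := ('M[R[i]]_N).
Implicit Types (A B Y Z L : R -> mx) (a : mx).

Lemma mx_is_derive_continuous A D : (forall s, mx_is_derive A s (D s)) ->
  forall i j, continuous (fun x => complex.Re (A x i j)) /\
    continuous (fun x => complex.Im (A x i j)).
Proof.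
move=> dA i j; split => s; have [[h1 _] [h2 _]] := dA s i j;
  exact/differentiable_continuous/derivable1_diffP.
Qed.

(** The bound |a| <= 1 + a^2 spares a square root. *)
Lemma mx_bounded A K : (forall x, mxnorm2 (A x) <= K) ->
  forall i j x, `|complex.Re (A x i j)| <= 1 + K /\ `|complex.Im (A x i j)| <= 1 + K.
Proof.
move=> AK i j x; have := le_trans (mxnorm2_entry (A x) i j) (AK x).
case: (A x i j) => a b /= h.
have a2 := sqr_ge0 a; have b2 := sqr_ge0 b.
by split; rewrite ler_norml; apply/andP; split; nra.
Qed.

Lemma mx_solution_bc L Y : mxci L ->
  (forall s, mx_is_derive Y s (- L s *m Y s)) -> mxbc Y.
Proof.
move=> Li dY; have [K hK] := mx_gronwall Li.
have b := mx_bounded (fun x => hK Y dY x 0).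
move=> i j; have [c1 c2] := mx_is_derive_continuous dY i j.
by split; split => //; eexists => x; [exact: (b i j x).1|exact: (b i j x).2].
Qed.

(** Uniqueness for the Cauchy problem: the Gronwall estimate is based at the point s where Y
    vanishes. *)
Lemma mx_solution_eq0 L Y s : mxci L ->
  (forall s, mx_is_derive Y s (- L s *m Y s)) -> Y s = 0 -> forall x, Y x = 0.
Proof.
move=> Li dY Ys x; have [K hK] := mx_gronwall Li.
by apply: mxnorm2_eq0; have := hK Y dY x s; rewrite Ys mxnorm20 mul0r.
Qed.

Lemma mx_derive_cvg Y D : (forall s, mx_is_derive Y s (D s)) -> mxci D ->
  (exists l, mxcvg -oo_R Y l) /\ (exists l, mxcvg +oo_R Y l).
Proof.
move=> dY Di.
have H ij : exists ll, ccvg -oo_R (fun x => Y x ij.1 ij.2) ll.1 /\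
    ccvg +oo_R (fun x => Y x ij.1 ij.2) ll.2.
  have [l [l1 l2]] := cFTC_line (fun x => dY x ij.1 ij.2) (Di ij.1 ij.2).
  by exists (l, l + Cintegral (fun x => D x ij.1 ij.2)).
have [l hl] := choice H.
by split; [exists (\matrix_(i, j) (l (i, j)).1) | exists (\matrix_(i, j) (l (i, j)).2)];
  move=> i j; rewrite mxE; have [] := hl (i, j).
Qed.

Lemma mxbc_tr A : mxbc A -> mxbc (fun x => (A x)^T).
Proof. by move=> hA i j; under eq_fun do rewrite mxE; exact: hA. Qed.

Lemma mxci_tr A : mxci A -> mxci (fun x => (A x)^T).
Proof. by move=> hA i j; under eq_fun do rewrite mxE; exact: hA. Qed.

(* The transpose of a solution of Z' = Z L solves Y' = - (- L^T) Y. *)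
Lemma mx_solution_bc_r L Z : mxci L ->
  (forall s, mx_is_derive Z s (Z s *m L s)) -> mxbc Z.
Proof.
move=> Li dZ.
have := @mx_solution_bc (fun s => - (L s)^T) (fun s => (Z s)^T)
  (mxciN (mxci_tr Li)).
move=> /(_ _)/mxbc_tr h.
have -> : Z = (fun x => (Z x)^T^T) by apply/funext => x; rewrite trmxK.
apply: h => s; rewrite opprK -trmx_mul; exact: mx_is_derive_tr.
Qed.

(** All that the brackets retain of the path-ordered exponential. P and Q share the limit G at
    opposite ends and tend to 1 at the other ones; this will place G on the right of a tensor at +oo
    and on its left at -oo. *)
Record Pexp_package L (P Q : R -> mx) (G : mx) : Prop := {
  P_derive : forall s, mx_is_derive P s (P s *m L s);
  Q_derive : forall s, mx_is_derive Q s (- L s *m Q s);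
  P_bc : mxbc P;
  Q_bc : mxbc Q;
  P_cvgNy : mxcvg -oo_R P G;
  P_cvgy : mxcvg +oo_R P 1%:M;
  Q_cvgNy : mxcvg -oo_R Q 1%:M;
  Q_cvgy : mxcvg +oo_R Q G
}.

Lemma mxcvg_comp (T T' : Type) (F : set_system T) (F' : set_system T')
   (f : T -> T') (A : T' -> mx) l :
  f @ F `=>` F' -> mxcvg F' A l -> mxcvg F (A \o f) l.
Proof.
move=> fF hA i j; have [h1 h2] := hA i j; split.
  by move=> S /h1; exact: fF.
by move=> S /h2; exact: fF.
Qed.

(** [is_Pexp] differentiates T in its first argument only. The second is reached through T(s, s') =
    Phi(s) Phi(s')^{-1} with Phi = T(., 0), which holds by uniqueness; every limit then reduces to
    those of Phi and of its inverse Psi. *)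
Lemma Pexp_line L T : mxci L -> is_Pexp L T ->
  Pexp_package L (T_to_pinfty T) (T_from_ninfty T) (T_line T).
Proof.
move=> Li hT.
have dT s' s : mx_is_derive (T^~ s') s (- L s *m T s s').
  have [_ /(_ s) [Tu [D dD e]]] := hT s'.
  by rewrite -e mulmxKV.
pose Phi s := T s 0; pose Psi s := invmx (Phi s).
have Tu s s' : T s s' \in unitmx by have [_ /(_ s) []] := hT s'.
have T1 s : T s s = 1%:M by have [] := hT s.
have dPhi s : mx_is_derive Phi s (- L s *m Phi s) by exact: dT.
have PsiPhi s : Psi s *m Phi s = 1%:M by rewrite mulVmx// Tu.
have PhiPsi s : Phi s *m Psi s = 1%:M by rewrite mulmxV// Tu.
have dPsi s : mx_is_derive Psi s (Psi s *m L s).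
  have [D dD] : exists D, mx_is_derive Psi s D.
    apply: derivable_invmx; first by move=> x; exact: Tu.
    by exists (- L s *m Phi s).
  (* Differentiating Psi Phi = 1 determines D. *)
  have := mx_is_deriveM dD (dPhi s).
  rewrite (_ : (fun x => _) = fun=> 1%:M); last by apply/funext => x; rewrite PsiPhi.
  move=> /mx_is_derive_unique /(_ (mx_is_derive_cst _ _)) h.
  suff -> : Psi s *m L s = D by [].
  have {}h : D *m Phi s = Psi s *m L s *m Phi s.
    by apply/eqP; rewrite -subr_eq0 -mulmxA -mulmxN -mulNmx h.
  by rewrite -[RHS]mulmx1 -(PhiPsi s) mulmxA h -(mulmxA _ (Phi s)) PhiPsi mulmx1.
have TE s s' : T s s' = Phi s *m Psi s'.
  apply/eqP; rewrite -subr_eq0; apply/eqP.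
  apply: (@mx_solution_eq0 L (fun s => T s s' - Phi s *m Psi s') s' Li) => /=; last first.
    by rewrite T1 PhiPsi subrr.
  move=> x; rewrite mulmxBr; apply: mx_is_deriveD; first exact: dT.
  have := mx_is_deriveM (dPhi x) (mx_is_derive_cst (- Psi s') x).
  rewrite mulmx0 addr0 mulmxN mulmxA.
  by under eq_fun do rewrite mulmxN.
have Phib := mx_solution_bc Li dPhi.
have Psib := mx_solution_bc_r Li dPsi.
have [[Pm hPm] [Pp hPp]] := mx_derive_cvg dPhi (mxciMl (mxciN Li) Phib).
have [[Sm hSm] [Sp hSp]] := mx_derive_cvg dPsi (mxciMr Psib Li).
have PhiPsiE : (fun s => Phi s *m Psi s) = fun=> 1%:M.
  by apply/funext => s; rewrite PhiPsi.
(* Phi Psi = 1 passes to the limit at both ends; this normalises P to 1 at +oo and Q to 1 at -oo. *)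
have PSp : Pp *m Sp = 1%:M.
  have h : mxcvg +oo_R (fun s => Phi s *m Psi s) (Pp *m Sp) by exact: mxcvgM.
  rewrite PhiPsiE in h.
  by apply: (mxcvg_unique h); exact: mxcvg_cst.
have PSm : Pm *m Sm = 1%:M.
  have h : mxcvg -oo_R (fun s => Phi s *m Psi s) (Pm *m Sm) by exact: mxcvgM.
  rewrite PhiPsiE in h.
  by apply: (mxcvg_unique h); exact: mxcvg_cst.
have PE : T_to_pinfty T = fun r => Pp *m Psi r.
  apply/funext => r; apply: mx_limE.
  by under eq_fun do rewrite TE; apply: mxcvgM => //; exact: mxcvg_cst.
have QE : T_from_ninfty T = fun r => Phi r *m Sm.
  apply/funext => r; apply: mx_limE.
  rewrite (_ : T r = fun s => Phi r *m Psi s); last by apply/funext => s; exact: TE.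
  by apply: mxcvgM => //; exact: mxcvg_cst.
have GE : T_line T = Pp *m Sm.
  apply: mx_limE; under eq_fun do rewrite TE.
  apply: (@mxcvgM _ _ _ _ _ (fun z => Phi z.1) (fun z => Psi z.2)).
    by apply: (mxcvg_comp (f := fst)) hPp; exact: cvg_fst.
  by apply: (mxcvg_comp (f := snd)) hSm; exact: cvg_snd.
rewrite PE QE GE; split.
- move=> s; have := mx_is_deriveM (mx_is_derive_cst Pp s) (dPsi s).
  by rewrite mul0mx add0r mulmxA.
- move=> s; have := mx_is_deriveM (dPhi s) (mx_is_derive_cst Sm s).
  by rewrite mulmx0 addr0 mulmxA.
- by apply: mxbcM => //; exact: mxbc_cst.
- by apply: mxbcM => //; exact: mxbc_cst.
- by apply: mxcvgM => //; exact: mxcvg_cst.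
- by rewrite -PSp; apply: mxcvgM => //; exact: mxcvg_cst.
- by rewrite -PSm; apply: mxcvgM => //; exact: mxcvg_cst.
- by apply: mxcvgM => //; exact: mxcvg_cst.
Qed.

End PathOrdered.

(** * The Killing form and the Casimir tensor *)

Section Killing.
Variables (R : realType) (g : vectType R) (br : g -> g -> g).
Hypothesis br_lie : is_lie_bracket br.
Local Notation kappa := (killing br).
Local Notation e := (tnth (vbasis {:g})).

Let brDl (a : R) x y z : br (a *: x + y) z = a *: br x z + br y z.
Proof. by have [] := br_lie. Qed.
Let brDr (a : R) x y z : br z (a *: x + y) = a *: br z x + br z y.
Proof. by have [] := br_lie. Qed.

Lemma lie_br0r x : br x 0 = 0.
Proof. by have := brDr (- 1) 0 0 x; rewrite scaler0 add0r scaleN1r addNr. Qed.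

Lemma lie_antisym x y : br x y = - br y x.
Proof.
have [_ _ alt _] := br_lie.
have := alt (1 *: x + y); rewrite brDl !brDr !alt !scale1r add0r addr0.
by move/eqP; rewrite addr_eq0 => /eqP.
Qed.

Lemma lie_jacobi x y z : br (br x y) z = br x (br y z) - br y (br x z).
Proof.
have [_ _ _ jac] := br_lie.
have := jac x y z; rewrite (lie_antisym z (br x y)) => /eqP.
rewrite subr_eq0 => /eqP <-; rewrite (lie_antisym z x).
by rewrite -scaleN1r -[_ *: _]addr0 brDr lie_br0r addr0 scaleN1r.
Qed.

Lemma vcoordP (a : R) i (x y : g) : vcoord i (a *: x + y) = a * vcoord i x + vcoord i y.
Proof. by rewrite /vcoord linearP. Qed.

Lemma vcoordE (x : g) : x = \sum_i vcoord i x *: e i.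
Proof.
rewrite {1}(coord_vbasis (memvf x)); apply: eq_bigr => i _.
by rewrite (tnth_nth 0).
Qed.

Definition glin (A : g -> g) := forall (a : R) x y, A (a *: x + y) = a *: A x + A y.

Lemma glin_sum (A : g -> g) (I : Type) (r : seq I) (a : I -> R) (x : I -> g) :
  glin A -> A (\sum_(i <- r) a i *: x i) = \sum_(i <- r) a i *: A (x i).
Proof.
move=> hA; elim: r => [|i r IH]; last by rewrite !big_cons hA IH.
rewrite !big_nil; have := hA (- 1) 0 0.
by rewrite scaler0 add0r scaleN1r addNr.
Qed.

Lemma glin_ad x : glin (br x). Proof. by move=> a y z; rewrite brDr. Qed.

(** Row-vector convention: composition is reversed, and [adm y *m adm x] is the matrix of ad x \o ad
    y. *)
Definition adm (x : g) : 'M[R]_(\dim {:g}) := \matrix_(i, j) vcoord j (br x (e i)).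

Lemma vcoord_sum i (I : Type) (r : seq I) (a : I -> R) (x : I -> g) :
  vcoord i (\sum_(k <- r) a k *: x k) = \sum_(k <- r) a k * vcoord i (x k).
Proof.
by rewrite /vcoord linear_sum /=; apply: eq_bigr => k _; rewrite linearZ.
Qed.

Lemma admM x y i j : (adm y *m adm x) i j = vcoord j (br x (br y (e i))).
Proof.
rewrite (vcoordE (br y (e i))) (glin_sum _ _ _ (glin_ad x)) vcoord_sum mxE.
by apply: eq_bigr => k _; rewrite !mxE.
Qed.

Lemma killingE x y : kappa x y = \tr (adm y *m adm x).
Proof. by apply: eq_bigr => i _; rewrite admM. Qed.

Lemma killingC x y : kappa x y = kappa y x.
Proof. by rewrite !killingE mxtrace_mulC. Qed.

Lemma adm_br x y : adm (br x y) = adm y *m adm x - adm x *m adm y.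
Proof.
apply/matrixP => i j; rewrite [LHS]mxE lie_jacobi [RHS]mxE [X in _ = _ + X]mxE !admM.
by rewrite /vcoord linearB.
Qed.

(** Cyclicity of the trace, as tr([a, b] c) = tr(a [b, c]). *)
Lemma killing_inv x y z : kappa (br x y) z = kappa x (br y z).
Proof.
rewrite !killingE !adm_br mulmxBr mulmxBl !raddfB /= !mulmxA.
by congr (_ - _); rewrite -[adm y *m _ *m _]mulmxA [RHS]mxtrace_mulC.
Qed.

Lemma killingDl (a : R) x y z : kappa (a *: x + y) z = a * kappa x z + kappa y z.
Proof.
rewrite /killing mulr_sumr -big_split /=; apply: eq_bigr => i _.
by rewrite brDl vcoordP.
Qed.

Lemma killingDr (a : R) x y z : kappa z (a *: x + y) = a * kappa z x + kappa z y.
Proof. by rewrite !(killingC z) killingDl. Qed.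

Lemma killing_sumr z (I : Type) (r : seq I) (a : I -> R) (x : I -> g) :
  kappa z (\sum_(i <- r) a i *: x i) = \sum_(i <- r) a i * kappa z (x i).
Proof.
elim: r => [|i r IH]; last by rewrite !big_cons killingDr IH.
rewrite !big_nil; have := killingDr (- 1) 0 0 z.
by rewrite scaler0 add0r mulN1r addNr.
Qed.

Lemma killing0r x : kappa x 0 = 0.
Proof. by have := killingDr (- 1) 0 0 x; rewrite scaler0 add0r mulN1r addNr. Qed.

Lemma killing_ad_skew z x y : kappa (br z x) y = - kappa x (br z y).
Proof.
rewrite (lie_antisym z x) -killing_inv -scaleN1r -[_ *: _]addr0 killingDl.
by rewrite (killingC 0) killing0r addr0 mulN1r.
Qed.

(** Real-linear forms with complex values. A tensor t enters only through the numbers \sum f z.1 * h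
    z.2 for such f and h. *)
Definition clin (f : g -> R[i]) :=
  forall (a : R) x y, f (a *: x + y) = (a%:C)%C * f x + f y.

Lemma clin_sum f (I : Type) (r : seq I) (a : I -> R) (x : I -> g) : clin f ->
  f (\sum_(i <- r) a i *: x i) = \sum_(i <- r) (a i)%:C%C * f (x i).
Proof.
move=> hf; elim: r => [|i r IH]; last by rewrite !big_cons hf IH.
rewrite !big_nil; have := hf (- 1) 0 0.
by rewrite scaler0 add0r rmorphN rmorph1 mulN1r addNr.
Qed.

Lemma clin_comp f (A : g -> g) : clin f -> glin A -> clin (fun x => f (A x)).
Proof. by move=> hf hA a x y /=; rewrite hA hf. Qed.

Variable C12 : tens2 g.
Hypothesis C12_kernel : is_kernel br C12 id.

Lemma casimir_eval f y : clin f ->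
  \sum_(w <- C12) (kappa w.2 y)%:C%C * f w.1 = f y.
Proof. by move=> hf; rewrite -clin_sum// -C12_kernel. Qed.

(* Expanding the second factor of t with the kernel of the identity. *)
Lemma kernel_flip t (A : g -> g) f h : clin f -> clin h -> is_kernel br t A ->
  \sum_(z <- t) f z.1 * h z.2 = \sum_(w <- C12) f (A w.2) * h w.1.
Proof.
move=> hf hh tA.
transitivity (\sum_(z <- t) \sum_(w <- C12) (kappa z.2 w.2)%:C%C * f z.1 * h w.1).
  apply: eq_bigr => z _; rewrite -{1}(casimir_eval z.2 hh) mulr_sumr.
  by apply: eq_bigr => w _; rewrite killingC; ring.
rewrite exchange_big /=; apply: eq_bigr => w _.
by rewrite tA clin_sum// mulr_suml.
Qed.

(** Symmetry of the Casimir tensor is a consequence of its being the kernel of the identity: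
    [kernel_flip] with t = C12. *)
Lemma casimir_sym f h : clin f -> clin h ->
  \sum_(w <- C12) f w.1 * h w.2 = \sum_(w <- C12) f w.2 * h w.1.
Proof. by move=> hf hh; rewrite (kernel_flip hf hh C12_kernel). Qed.

Lemma kernelE t (A : g -> g) f h : clin f -> clin h -> glin A -> is_kernel br t A ->
  \sum_(z <- t) f z.1 * h z.2 = \sum_(w <- C12) f (A w.1) * h w.2.
Proof.
move=> hf hh hA tA; rewrite (kernel_flip hf hh tA).
by rewrite (casimir_sym (clin_comp hf hA) hh).
Qed.

(** Expanding A w_1 by the reproducing property of C12 brings A inside kappa, where it passes to the
    other argument as A'. This moves operators between the two tensor factors. *)
Lemma casimir_adjoint (A A' : g -> g) f h : clin f -> clin h ->
  (forall x y, kappa (A x) y = kappa x (A' y)) ->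
  \sum_(w <- C12) f (A w.1) * h w.2 = \sum_(w <- C12) f w.1 * h (A' w.2).
Proof.
move=> hf hh adj.
transitivity (\sum_(w <- C12) \sum_(v <- C12)
    (kappa w.1 (A' v.2))%:C%C * f v.1 * h w.2).
  apply: eq_bigr => w _; rewrite -{1}(casimir_eval (A w.1) hf) mulr_suml.
  by apply: eq_bigr => v _; rewrite killingC adj.
rewrite exchange_big /=; apply: eq_bigr => v _.
rewrite -(casimir_eval (A' v.2) hh) mulr_sumr.
have hk : clin (fun x => (kappa x (A' v.2))%:C%C * f v.1).
  by move=> a x y; rewrite killingDl rmorphD rmorphM; ring.
rewrite (casimir_sym hk hh); apply: eq_bigr => w _; ring.
Qed.

End Killing.

(** * The mCYBE contracted with the Casimir tensor *)

Section YangBaxter.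
Variables (R : realType) (g : vectType R) (br : g -> g -> g).
Hypothesis br_lie : is_lie_bracket br.
Variables (C12 : tens2 g) (C12_kernel : is_kernel br C12 id).
Variables (c : R[i]) (Rop : g -> g).
Hypotheses (Rop_lin : glin Rop) (R_skew : killing_skew br Rop)
  (R_mCYBE : mCYBE br c Rop).

Lemma killing_oppr x y : killing br x (- y) = - killing br x y.
Proof.
by rewrite -scaleN1r -[_ *: _]addr0 killingDr// killing0r// addr0 mulN1r.
Qed.

Lemma clin_opp (f : g -> R[i]) x : clin f -> f (- x) = - f x.
Proof.
move=> hf; have f0 : f 0 = 0.
  by have := hf (- 1) 0 0; rewrite scaler0 add0r rmorphN rmorph1 mulN1r addNr.
by have := hf (- 1) x 0; rewrite f0 !addr0 scaleN1r rmorphN rmorph1 mulN1r.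
Qed.

(* Both sides are brought to the form sum_w B1 (A w_1) * B2 w_2, where A is
   respectively R^s ad_X R^{-s'} and ad_{R^s X} M - M ad_{R^{s'} X} with
   M = R + m; then c2 = c1 - 2 m and m (m - c1) = 0 turn mCYBE into the
   equality of the two operators. *)
Lemma casimir_mCYBE (c1 c2 m : R[i]) (B1 B2 : g -> R[i]) (X : g) :
  c1 ^+ 2 = ((complex.Re (c ^+ 2))%:C)%C -> c2 = c1 - m * 2 -> m * (m - c1) = 0 ->
  clin B1 -> clin B2 ->
  \sum_(w <- C12) (B2 (Rop w.1) + c2 * B2 w.1)
      * (B1 (Rop (br X w.2)) + c1 * B1 (br X w.2))
  = - \sum_(w <- C12)
     (((B1 (br (Rop X) (Rop w.1)) + c1 * B1 (br X (Rop w.1))) * B2 w.2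
       + B1 (Rop w.1) * (B2 (br (Rop X) w.2) + c2 * B2 (br X w.2)))
    + m * ((B1 (br (Rop X) w.1) + c1 * B1 (br X w.1)) * B2 w.2
       + B1 w.1 * (B2 (br (Rop X) w.2) + c2 * B2 (br X w.2)))).
Proof.
move=> c1E c2E mE hB1 hB2.
have lad Z := glin_ad br_lie Z.
have adR x y : killing br (Rop x) y = killing br x (- Rop y).
  by rewrite R_skew killing_oppr.
have adad Z x y : killing br (br Z x) y = killing br x (- br Z y).
  by rewrite killing_ad_skew// killing_oppr.
(* R and every ad_Z are skew for kappa, so each can be moved to the first factor at the price of a
   sign. *)
have moveR f : clin f -> \sum_(w <- C12) f w.1 * B2 (Rop w.2)
    = - \sum_(w <- C12) f (Rop w.1) * B2 w.2.
  move=> hf; rewrite (casimir_adjoint br_lie C12_kernel hf hB2 adR) -sumrN.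
  by apply: eq_bigr => w _; rewrite clin_opp// mulrN opprK.
have movead Z f : clin f -> \sum_(w <- C12) f w.1 * B2 (br Z w.2)
    = - \sum_(w <- C12) f (br Z w.1) * B2 w.2.
  move=> hf; rewrite (casimir_adjoint br_lie C12_kernel hf hB2 (adad Z)) -sumrN.
  by apply: eq_bigr => w _; rewrite clin_opp// mulrN opprK.
have lhs1 : clin (fun x => B1 (Rop (br X x)) + c1 * B1 (br X x)).
  by move=> a x y; rewrite !lad !Rop_lin !hB1; ring.
have lhs2 : clin (fun x => B2 (Rop x) + c2 * B2 x).
  by move=> a x y; rewrite !Rop_lin !hB2; ring.
rewrite (casimir_sym br_lie C12_kernel lhs2 lhs1).
have lR : clin (fun x => B1 (Rop x)) by exact: clin_comp.
have -> : \sum_(w <- C12) (B2 (Rop w.2) + c2 * B2 w.2) *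
     (B1 (Rop (br X w.1)) + c1 * B1 (br X w.1)) =
  \sum_(w <- C12) (B1 (Rop (br X w.1)) + c1 * B1 (br X w.1)) * B2 (Rop w.2)
  + \sum_(w <- C12) c2 * ((B1 (Rop (br X w.1)) + c1 * B1 (br X w.1)) * B2 w.2).
  by rewrite -big_split /=; apply: eq_bigr => w _; ring.
rewrite (moveR _ lhs1).
have -> : \sum_(w <- C12)
     (((B1 (br (Rop X) (Rop w.1)) + c1 * B1 (br X (Rop w.1))) * B2 w.2
       + B1 (Rop w.1) * (B2 (br (Rop X) w.2) + c2 * B2 (br X w.2)))
    + m * ((B1 (br (Rop X) w.1) + c1 * B1 (br X w.1)) * B2 w.2
       + B1 w.1 * (B2 (br (Rop X) w.2) + c2 * B2 (br X w.2)))) =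
  \sum_(w <- C12) ((B1 (br (Rop X) (Rop w.1)) + c1 * B1 (br X (Rop w.1)))
     + m * (B1 (br (Rop X) w.1) + c1 * B1 (br X w.1))) * B2 w.2
  + \sum_(w <- C12) B1 (Rop w.1) * B2 (br (Rop X) w.2)
  + c2 * \sum_(w <- C12) B1 (Rop w.1) * B2 (br X w.2)
  + m * \sum_(w <- C12) B1 w.1 * B2 (br (Rop X) w.2)
  + m * c2 * \sum_(w <- C12) B1 w.1 * B2 (br X w.2).
  rewrite !mulr_sumr -!big_split /=; apply: eq_bigr => w _; ring.
rewrite !(movead _ _ lR) !(movead _ _ hB1) !mulrN !mulr_sumr -!sumrN -!big_split /=.
rewrite -sumrN; apply: eq_bigr => w _.
(* With all operators on w_1, the mCYBE at (X, w_1) eliminates [R X, R w_1]. *)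
have := R_mCYBE X w.1; set x := br (Rop X) (Rop w.1).
have -> : Rop (br (Rop X) w.1 + br X (Rop w.1)) =
  Rop (br (Rop X) w.1) + Rop (br X (Rop w.1)).
  by rewrite -[br (Rop X) w.1]scale1r Rop_lin !scale1r.
move=> /eqP; rewrite subr_eq => /eqP ->.
rewrite scaleNr -scalerN hB1 -[Rop (br (Rop X) _)]scale1r hB1 rmorph1 clin_opp//.
rewrite -c1E c2E.
apply/eqP; rewrite -subr_eq0; apply/eqP.
(* The only surviving term is this multiple of ad_X, and [mE] annihilates it. *)
transitivity (2 * (m * (m - c1)) * B1 (br X w.1) * B2 w.2); last by rewrite mE; ring.
rewrite scale1r.
ring.
Qed.

End YangBaxter.

(** * Brackets of the monodromy matrices *)

Section FieldRegularity.
Variables (R : realType) (g : vectType R) (br : g -> g -> g).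
Hypothesis br_lie : is_lie_bracket br.
Local Notation kappa := (killing br).
Local Notation e := (tnth (vbasis {:g})).
Implicit Types (X Y b : R -> g).

Lemma bcont_sum (I : Type) (r : seq I) (f : I -> R -> R) :
  (forall i, bcont (f i)) -> bcont (fun x => \sum_(i <- r) f i x).
Proof.
move=> df; elim: r => [|i r IH].
  rewrite (_ : (fun _ => _) = fun=> 0); first exact: bcont_cst.
  by apply/funext => x; rewrite big_nil.
rewrite (_ : (fun _ => _) = fun x => f i x + \sum_(j <- r) f j x).
  exact: bcontD.
by apply/funext => x; rewrite big_cons.
Qed.

Lemma cinteg_sum (I : Type) (r : seq I) (f : I -> R -> R) :
  (forall i, cinteg (f i)) -> cinteg (fun x => \sum_(i <- r) f i x).
Proof.
move=> df; elim: r => [|i r IH].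
  rewrite (_ : (fun _ => _) = fun=> 0); first exact: cinteg0.
  by apply/funext => x; rewrite big_nil.
rewrite (_ : (fun _ => _) = fun x => f i x + \sum_(j <- r) f j x).
  exact: cintegD.
by apply/funext => x; rewrite big_cons.
Qed.

Definition bcv b := forall i, bcont (fun x => vcoord i (b x)).

Lemma test_fun_bcont (h : R -> R) : test_fun h -> bcont h.
Proof.
move=> [dh [M hM]].
have ch : continuous h.
  by move=> x; apply/differentiable_continuous/derivable1_diffP; exact: (dh 0%N x).
split => //.
have cK : compact (h @` `[- M, M]).
  apply: continuous_compact; last exact: segment_compact.
  by apply: continuous_subspaceT.
have [K [_ hK]] := compact_bounded cK.
have K1 : K < `|K| + 1 by rewrite (le_lt_trans (ler_norm _))// ltrDl.
exists (`|K| + 1) => x; have [xM|Mx] := leP `|x| M; last first.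
  by rewrite hM// normr0 addr_ge0.
apply: (hK _ K1); exists x => //=.
by rewrite in_itv/= -ler_norml.
Qed.

Lemma g_test_fun_bcv b : g_test_fun b -> bcv b.
Proof. by move=> hb i; exact: test_fun_bcont. Qed.

(** Expansion in the structure constants of the basis reduces this to products of a bounded and an
    integrable function. *)
Lemma continuous_integrable_br X b : continuous_integrable X -> bcv b ->
  continuous_integrable (fun x => br (X x) (b x)).
Proof.
move=> hX hb k.
have brl y : glin (fun x => br x y).
  by move=> a u v; have [brD _ _ _] := br_lie; exact: brD.
suff : cinteg (fun x => vcoord k (br (X x) (b x))) by [].
rewrite (_ : (fun x => _) = fun x => \sum_j \sum_i
   (vcoord j (b x) * vcoord k (br (e i) (e j))) * vcoord i (X x)).
  apply: cinteg_sum => j; apply: cinteg_sum => i; apply: cintegM; last exact: hX.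
  by apply: bcontM; [exact: hb|exact: bcont_cst].
apply/funext => x; rewrite {1}(vcoordE (b x)) (glin_sum _ _ _ (glin_ad br_lie _)).
rewrite vcoord_sum; apply: eq_bigr => j _.
rewrite {1}(vcoordE (X x)).
rewrite (glin_sum _ _ _ (brl (e j))) vcoord_sum mulr_sumr.
by apply: eq_bigr => i _; rewrite mulrAC mulrA.
Qed.

Lemma continuous_integrable_brC X b : continuous_integrable X -> bcv b ->
  continuous_integrable (fun x => br (b x) (X x)).
Proof.
move=> hX hb; rewrite (_ : (fun x => _) = fun x => br (X x) (- b x)).
  apply: continuous_integrable_br => // i.
  rewrite (_ : (fun x => _) = fun x => - vcoord i (b x)).
    exact: bcontN.
  by apply/funext => x; rewrite /vcoord linearN.
apply/funext => x; have := glin_ad br_lie (X x) (- 1) (b x) 0.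
by rewrite (lie_br0r br_lie) !addr0 !scaleN1r => ->; rewrite (lie_antisym br_lie).
Qed.

Lemma continuous_integrable0 : continuous_integrable (fun=> 0 : g).
Proof.
move=> i; suff : cinteg (fun=> vcoord i (0 : g)) by [].
by rewrite /vcoord linear0; exact: cinteg0.
Qed.

Lemma cci_clin (f : R -> g -> R[i]) Y : (forall x, clin (f x)) ->
  (forall y, cbc (fun x => f x y)) -> continuous_integrable Y ->
  cci (fun x => f x (Y x)).
Proof.
move=> hf bf hY.
rewrite (_ : (fun x => _) = fun x => \sum_i f x (e i) * (vcoord i (Y x))%:C%C).
  apply: cci_sum => i; apply: cciM => //.
  by split; [exact: hY|exact: cinteg0].
apply/funext => x; rewrite {1}(vcoordE (Y x)) (clin_sum _ _ _ (hf x)).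
by apply: eq_bigr => i _; rewrite mulrC.
Qed.

Lemma bcv_sum (t : tens2 g) (f : R -> g -> R) :
  (forall y, bcont (fun x => f x y)) ->
  bcv (fun x => \sum_(w <- t) f x w.1 *: w.2).
Proof.
move=> hf i; under eq_fun do rewrite vcoord_sum.
apply: bcont_sum => w; apply: bcontM => //; exact: bcont_cst.
Qed.

End FieldRegularity.

(** * Variations of X and brackets of monodromy entries *)

Section Monodromy.
Variables
    (R : realType)
    (g : vectType R) (br : g -> g -> g)
    (br_lie : is_lie_bracket br)
    (c : R[i]) (c_1i : c = 1 \/ c = ('i)%C)
    (Rop : 'End(g)) (R_skew : killing_skew br Rop) (R_mCYBE : mCYBE br c Rop)
    (C12 R12 : tens2 g)
    (C12_kernel : is_kernel br C12 id) (R12_kernel : is_kernel br R12 Rop)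
    (gamma : R)
    (N : nat) (rho : g -> 'M[R[i]]_N) (rho_rep : is_lie_rep br rho)
    (P : Type) (Obs : set (P -> R[i]))
    (pb : (P -> R[i]) -> (P -> R[i]) -> P -> R[i])
    (Obs_poisson : is_poisson_algebra Obs pb)
    (X : P -> R -> g)
    (X_int : forall p, continuous_integrable (X p))
    (X_obs : forall b, g_test_fun b -> Obs (X_smeared br X b))
    (XX : bracket_XX br X pb C12).
Local Notation kappa := (killing br).

Let Rop_lin : glin Rop. Proof. by move=> a x y; rewrite linearP. Qed.

Definition lax (s : bool) (x : gC g) : 'M[R[i]]_N :=
  rhoC rho (gC_scale (gamma%:C)%C (Rpm Rop c s x)).

Lemma rho_lin (a : R) x y : rho (a *: x + y) = (a%:C)%C *: rho x + rho y.
Proof. by have [] := rho_rep. Qed.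

Lemma laxE s x : lax s x = (gamma%:C)%C *:
  ((rho (Rop x.1) + pm s c *: rho x.1)
   + 'i%C *: (rho (Rop x.2) + pm s c *: rho x.2)).
Proof.
rewrite /lax /rhoC /gC_scale /Rpm /gC_add /gC_scale /=.
set k := pm s c; rewrite !scale0r subr0 addr0.
have rZ (a : R) y : rho (a *: y) = a%:C%C *: rho y.
  have r0 : rho 0 = 0.
    have := rho_lin (- 1) 0 0.
    by rewrite scaler0 add0r rmorphN rmorph1 scaleN1r addNr.
  by rewrite -[a *: y]addr0 rho_lin r0 addr0.
have rD y z : rho (y + z) = rho y + rho z.
  by rewrite -[y]scale1r rho_lin rmorph1 !scale1r.
rewrite !rZ !rD -!scaleNr !rZ.
apply/matrixP => i j; rewrite !mxE rmorphN /=.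
(* [gC_scale] mixes the two components through Re k and Im k; once k is split, the sides differ by a
   multiple of i^2 + 1. *)
have kE : k = (complex.Re k)%:C%C + 'i%C * (complex.Im k)%:C%C.
  by case: (k) => a b; apply: eq_ReIm;
  rewrite ?cReD ?cImD ?cReM ?cImM /=; ring.
have i2 : 'i%C * 'i%C = -1 :> R[i] by rewrite -expr2 sqr_i.
rewrite [in RHS]kE.
set a := (complex.Re k)%:C%C; set b := (complex.Im k)%:C%C.
apply/eqP; rewrite -subr_eq0; apply/eqP.
transitivity (- ((gamma%:C)%C * b * rho x.2 i j) * ('i%C * 'i%C + 1)); first by ring.
by rewrite i2 addNr mulr0.
Qed.

Definition lax_real (s : bool) (y : g) : 'M[R[i]]_N :=
  (gamma%:C)%C *: (rho (Rop y) + pm s c *: rho y).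

Lemma lax_realE s y : lax s (gC_of y) = lax_real s y.
Proof.
rewrite laxE /gC_of /= linear0.
have -> : rho 0 = 0.
  by have := rho_lin (- 1) 0 0; rewrite scaler0 add0r rmorphN rmorph1 scaleN1r addNr.
by rewrite scaler0 addr0 scaler0 addr0.
Qed.

(** Needed because a monodromy entry is a complex observable, so the variation of X that it
    generates lies in the complexification. *)
Lemma laxE_real s x : lax s x = lax_real s x.1 + 'i%C *: lax_real s x.2.
Proof. by rewrite laxE /lax_real scalerDr; congr (_ + _); rewrite !scalerA mulrC. Qed.

Lemma sandwich_addZ (A B U V : 'M[R[i]]_N) (k : R[i]) i j :
  (A *m (U + k *: V) *m B) i j = (A *m U *m B) i j + k * (A *m V *m B) i j.
Proof. by rewrite mulmxDr mulmxDl -scalemxAr -scalemxAl mxE [X in _ + X]mxE. Qed.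

(** With A = P(r) and B = Q(r) these forms carry the r-dependence of the primitive of the
    integrand. *)
Definition sandwich (A B : 'M[R[i]]_N) i j (x : g) : R[i] := (A *m rho x *m B) i j.

Lemma sandwich_lin A B i j : clin (sandwich A B i j).
Proof.
move=> a x y; rewrite /sandwich rho_lin mulmxDr mulmxDl -scalemxAr -scalemxAl.
by rewrite mxE [X in X + _]mxE.
Qed.

Lemma lax_sandwich s (A B : 'M[R[i]]_N) i j y : (A *m lax_real s y *m B) i j =
  (gamma%:C)%C * (sandwich A B i j (Rop y) + pm s c * sandwich A B i j y).
Proof.
rewrite /lax_real /sandwich -scalemxAr -scalemxAl mulmxDr mulmxDl.
rewrite -scalemxAr -scalemxAl.
by rewrite mxE [X in _ * X]mxE [X in _ * (_ + X)]mxE.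
Qed.

Lemma lax_sandwich_lin s (A B : 'M[R[i]]_N) i j :
  clin (fun y => (A *m lax_real s y *m B) i j).
Proof.
have -> : (fun y => (A *m lax_real s y *m B) i j) = fun y => (gamma%:C)%C *
    (sandwich A B i j (Rop y) + pm s c * sandwich A B i j y).
  by apply/funext => y; exact: lax_sandwich.
move=> a x y; have := sandwich_lin A B i j; move: (sandwich A B i j) (pm s c) => f k hf.
by rewrite Rop_lin !hf; ring.
Qed.

Lemma mxci_lax s p : mxci (fun r => lax s (gC_of (X p r))).
Proof.
move=> i j; rewrite (_ : (fun r => _) =
    fun r => (1%:M *m lax_real s (X p r) *m 1%:M) i j).
  apply: (@cci_clin _ _ (fun _ y => (1%:M *m lax_real s y *m 1%:M) i j)) => //.
  - by move=> _; exact: lax_sandwich_lin.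
  - by move=> y; exact: cbc_cst.
by apply/funext => r; rewrite lax_realE mul1mx mulmx1.
Qed.

(** Invariance of kappa and the kernel property of C12 collapse the smeared bracket to -kappa(b',
    [X, b]) = kappa(b', [b, X]). *)
Lemma X_smeared_variation b p : g_test_fun b ->
  is_X_variation br X pb (X_smeared br X b) p (fun x => gC_of (br (b x) (X p x))).
Proof.
move=> hb; split.
- by apply: (continuous_integrable_brC br_lie) => //; exact: g_test_fun_bcv.
- exact: continuous_integrable0.
move=> b' hb'; rewrite XX//; apply: eq_ReIm => /=; last first.
  rewrite (_ : (fun x => _) = fun=> 0); first by rewrite Rintegral_cst// mul0r.
  by apply/funext => x; rewrite (killing0r br_lie).
apply: eq_Rintegral => x _.
rewrite /killing12 /br2 big_map /=.
transitivity
  (- \sum_(z <- C12) killing br z.2 (br (X p x) (b x)) * killing br z.1 (b' x)).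
  by congr (- _); apply: eq_bigr => z _; rewrite (killing_inv br_lie) mulrC.
have -> : \sum_(z <- C12) kappa z.2 (br (X p x) (b x)) * kappa z.1 (b' x) =
   kappa (b' x) (br (X p x) (b x)).
  rewrite [in RHS](C12_kernel (br (X p x) (b x))) (killing_sumr br_lie).
  by apply: eq_bigr => z _; rewrite (killingC br_lie z.1).
by rewrite -(killing_oppr br_lie) -(lie_antisym br_lie).
Qed.

Variable T : bool -> P -> R -> R -> 'M[R[i]]_N.
Hypothesis T_Pexp : forall s p, is_Pexp (fun x => lax s (gC_of (X p x))) (T s p).
Hypothesis T_obs : forall s i j, Obs (fun p => T_line (T s p) i j).
Hypothesis T_var : forall s, variation_formula br X pb Obs (lax s) (T s).

Local Notation Gam s p := (T_line (T s p)).
Local Notation Pp s p := (T_to_pinfty (T s p)).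
Local Notation Qq s p := (T_from_ninfty (T s p)).

Lemma T_package s p :
  Pexp_package (fun x => lax s (gC_of (X p x))) (Pp s p) (Qq s p) (Gam s p).
Proof. by apply: Pexp_line => //; exact: mxci_lax. Qed.

Definition phi s p k l r y : R[i] := (Pp s p r *m lax_real s y *m Qq s p r) k l.

Lemma phi_lin s p k l r : clin (phi s p k l r).
Proof. exact: lax_sandwich_lin. Qed.

Lemma phi_bc s p k l y : cbc (fun r => phi s p k l r y).
Proof.
have [_ _ hP hQ _ _ _ _] := T_package s p.
by apply: (mxbcM (mxbcM hP _) hQ) => i j; exact: cbc_cst.
Qed.

(** The element W(r) representing the form [phi] through kappa, given by its real and imaginary
    components since kappa is real. *)
Definition dualW s p k l r : gC g :=
  (\sum_(w <- C12) complex.Re (phi s p k l r w.1) *: w.2,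
   \sum_(w <- C12) complex.Im (phi s p k l r w.1) *: w.2).

Lemma dualW_Re s p k l r y :
  kappa y (dualW s p k l r).1 = complex.Re (phi s p k l r y).
Proof.
rewrite -(casimir_eval C12_kernel y (phi_lin s p k l r)).
rewrite (killing_sumr br_lie) Re_sum.
apply: eq_bigr => w _.
by rewrite cReM /= mul0r subr0 mulrC (killingC br_lie).
Qed.

Lemma dualW_Im s p k l r y :
  kappa y (dualW s p k l r).2 = complex.Im (phi s p k l r y).
Proof.
rewrite -(casimir_eval C12_kernel y (phi_lin s p k l r)).
rewrite (killing_sumr br_lie) Im_sum.
apply: eq_bigr => w _.
by rewrite cImM /= mul0r addr0 mulrC (killingC br_lie).
Qed.

(** Invariance frees the test function: phi([b, X]) = kappa([b, X], W) = kappa(b, [X, W]).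
    Boundedness of P and Q makes W bounded, so that [X, W] is integrable like X. *)
Lemma Gamma_variation s p k l :
  is_X_variation br X pb (fun q => Gam s q k l) p
    (fun r => (br (X p r) (dualW s p k l r).1, br (X p r) (dualW s p k l r).2)).
Proof.
split.
- apply: (continuous_integrable_br br_lie) => //.
  apply: (@bcv_sum _ _ C12 (fun r y => complex.Re (phi s p k l r y))) => y.
  by have [] := phi_bc s p k l y.
- apply: (continuous_integrable_br br_lie) => //.
  apply: (@bcv_sum _ _ C12 (fun r y => complex.Im (phi s p k l r y))) => y.
  by have [] := phi_bc s p k l y.
move=> b hb.
rewrite (pb_antisym Obs_poisson) //; last exact: X_obs.
rewrite (@T_var _ _ _ _ (X_obs hb) (X_smeared_variation p hb)) opprK.
congr Cintegral; apply/funext => r.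
rewrite lax_realE -/(phi s p k l r (br (b r) (X p r))).
rewrite /= -!(killing_inv br_lie) dualW_Re dualW_Im.
by case: (phi _ _ _ _ _ _).
Qed.

Lemma Gamma_bracket_integral s s' p i j k l :
  pb (fun q => Gam s q i j) (fun q => Gam s' q k l) p =
  - Cintegral (fun r => \sum_(w <- C12)
      phi s' p k l r w.1 * phi s p i j r (br (X p r) w.2)).
Proof.
rewrite (@T_var _ _ _ _ (T_obs s' k l) (Gamma_variation s' p k l)).
congr (- Cintegral _); apply/funext => r.
rewrite laxE_real sandwich_addZ.
transitivity (phi s p i j r (br (X p r) (dualW s' p k l r).1) +
    'i%C * phi s p i j r (br (X p r) (dualW s' p k l r).2)); first by [].
have lX : glin (br (X p r)) := glin_ad br_lie _.
rewrite /dualW /= !(glin_sum _ _ _ lX) !(clin_sum _ _ _ (phi_lin _ _ _ _ _)).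
rewrite mulr_sumr -big_split /=; apply: eq_bigr => w _.
(* The real and imaginary parts of [phi s'] recombine into its complex value. *)
rewrite mulrA -mulrDl; congr (_ * _).
by case: (phi s' _ _ _ _ _) => a b; apply: eq_ReIm;
  rewrite ?cReD ?cImD ?cReM ?cImM /=; ring.
Qed.

Lemma rho_br x y : rho (br x y) = rho x *m rho y - rho y *m rho x.
Proof. by have [_ ->] := rho_rep. Qed.

(** From P' = P L and Q' = - L Q, the derivative of P rho(x) Q is P [L, rho(x)] Q; since rho is a
    representation, this is again a sandwich, with ad applied to x. *)
Lemma sandwich_derive s p i j x r :
  cderive (fun r => sandwich (Pp s p r) (Qq s p r) i j x) r
    ((gamma%:C)%C *
      (sandwich (Pp s p r) (Qq s p r) i j (br (Rop (X p r)) x)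
       + pm s c * sandwich (Pp s p r) (Qq s p r) i j (br (X p r) x))).
Proof.
have [dP dQ _ _ _ _ _ _] := T_package s p.
have := mx_is_deriveM (mx_is_deriveM (dP r) (mx_is_derive_cst (rho x) r)) (dQ r).
move=> /(_ i j); congr (cderive _ r _).
rewrite mulmx0 addr0 lax_realE /lax_real /sandwich !rho_br.
move: (Pp s p r) (Qq s p r) (pm s c) (gamma%:C)%C => A B k a.
set U := rho (Rop _); set V := rho (X p r); set Z := rho x.
have -> : A *m (a *: (U + k *: V)) *m Z *m B + A *m Z *m (- (a *: (U + k *: V)) *m B) =
   a *: (A *m ((U *m Z - Z *m U) + k *: (V *m Z - Z *m V)) *m B).
  rewrite mulNmx mulmxN !(mulmxA _ _ B) -mulmxBl scalemxAl; congr (_ *m B).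
  rewrite -!mulmxA -mulmxBr scalemxAr; congr (A *m _).
  rewrite -scalemxAl -scalemxAr -scalerBr; congr (a *: _).
  rewrite mulmxDl mulmxDr -scalemxAl -scalemxAr scalerBr.
  by rewrite opprD addrACA.
by rewrite mxE sandwich_addZ.
Qed.

(** Here P tends to 1 and Q to the monodromy; at -oo the roles are exchanged. The two orders of the
    product become the two terms of the commutator. *)
Lemma sandwich_cvgy s p i j x :
  ccvg +oo_R (fun r => sandwich (Pp s p r) (Qq s p r) i j x)
    ((rho x *m Gam s p) i j).
Proof.
have [_ _ _ _ _ hP _ hQ] := T_package s p.
have -> : rho x *m Gam s p = 1%:M *m rho x *m Gam s p by rewrite mul1mx.
have hx : mxcvg +oo_R (fun=> rho x) (rho x) by exact: mxcvg_cst.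
have hPx : mxcvg +oo_R (fun r => Pp s p r *m rho x) (1%:M *m rho x).
  exact: mxcvgM hP hx.
have h : mxcvg +oo_R (fun r => Pp s p r *m rho x *m Qq s p r) (1%:M *m rho x *m Gam s p).
  exact: mxcvgM hPx hQ.
exact: h.
Qed.

Lemma sandwich_cvgNy s p i j x :
  ccvg -oo_R (fun r => sandwich (Pp s p r) (Qq s p r) i j x)
    ((Gam s p *m rho x) i j).
Proof.
have [_ _ _ _ hP _ hQ _] := T_package s p.
have -> : Gam s p *m rho x = Gam s p *m rho x *m 1%:M by rewrite mulmx1.
have hx : mxcvg -oo_R (fun=> rho x) (rho x) by exact: mxcvg_cst.
have hPx : mxcvg -oo_R (fun r => Pp s p r *m rho x) (Gam s p *m rho x).
  exact: mxcvgM hP hx.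
have h : mxcvg -oo_R (fun r => Pp s p r *m rho x *m Qq s p r) (Gam s p *m rho x *m 1%:M).
  exact: mxcvgM hPx hQ.
exact: h.
Qed.

Lemma pm_sqr s : pm s c ^+ 2 = ((complex.Re (c ^+ 2))%:C)%C.
Proof.
rewrite /pm exprMn sqrr_sign mul1r.
case: c_1i => ->; first by rewrite expr1n.
by rewrite sqr_i; apply: eq_ReIm => //=; rewrite oppr0.
Qed.

Lemma phiE s p k l r y : phi s p k l r y = (gamma%:C)%C *
  (sandwich (Pp s p r) (Qq s p r) k l (Rop y)
   + pm s c * sandwich (Pp s p r) (Qq s p r) k l y).
Proof. exact: lax_sandwich. Qed.

(** The entry (ij, kl) of gamma P_1 P'_2 M_{12} Q_1 Q'_2 for M = R + m, with M_{12} written as M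
    acting on the first factor of C12. *)
Definition bracket_prim (m : R[i]) s s' p i j k l r : R[i] :=
  (gamma%:C)%C * \sum_(w <- C12)
    (sandwich (Pp s p r) (Qq s p r) i j (Rop w.1)
       * sandwich (Pp s' p r) (Qq s' p r) k l w.2
     + m * (sandwich (Pp s p r) (Qq s p r) i j w.1
       * sandwich (Pp s' p r) (Qq s' p r) k l w.2)).

Lemma bracket_prim_derive (m : R[i]) s s' p i j k l r :
  pm s' c = pm s c - m * 2 -> m * (m - pm s c) = 0 ->
  cderive (bracket_prim m s s' p i j k l) r
    (- \sum_(w <- C12) phi s' p k l r w.1 * phi s p i j r (br (X p r) w.2)).
Proof.
move=> s'E mE.
have H := casimir_mCYBE br_lie C12_kernel Rop_lin R_skew R_mCYBE (X p r)
  (pm_sqr s) s'E mE (sandwich_lin (Pp s p r) (Qq s p r) i j)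
  (sandwich_lin (Pp s' p r) (Qq s' p r) k l).
have -> : \sum_(w <- C12) phi s' p k l r w.1 * phi s p i j r (br (X p r) w.2) =
  (gamma%:C)%C ^+ 2 * \sum_(w <- C12)
     (sandwich (Pp s' p r) (Qq s' p r) k l (Rop w.1)
      + pm s' c * sandwich (Pp s' p r) (Qq s' p r) k l w.1) *
     (sandwich (Pp s p r) (Qq s p r) i j (Rop (br (X p r) w.2))
      + pm s c * sandwich (Pp s p r) (Qq s p r) i j (br (X p r) w.2)).
  rewrite mulr_sumr; apply: eq_bigr => w _; rewrite !phiE.
  by rewrite mulrACA -expr2.
(* One factor gamma is the prefactor of the primitive; the other comes from the Lax matrix on
   differentiation. *)
rewrite H mulrN opprK expr2 -mulrA; apply: cderiveZ.
rewrite mulr_sumr; apply: cderive_sum => w.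
have d1 x := sandwich_derive s p i j x r.
have d2 := sandwich_derive s' p k l w.2 r.
have := cderiveD (cderiveM (d1 (Rop w.1)) d2) (cderiveZ m (cderiveM (d1 w.1) d2)).
congr (cderive _ r _).
move: (sandwich (Pp s p r) (Qq s p r) i j) (sandwich (Pp s' p r) (Qq s' p r) k l).
move: (pm s c) (pm s' c) (gamma%:C)%C => c1 c2 a f h; ring.
Qed.

Lemma Gamma_bracket (m : R[i]) s s' p i j k l :
  pm s' c = pm s c - m * 2 -> m * (m - pm s c) = 0 ->
  pb (fun q => Gam s q i j) (fun q => Gam s' q k l) p =
  (gamma%:C)%C * (\sum_(w <- C12)
     ((rho (Rop w.1) *m Gam s p) i j * (rho w.2 *m Gam s' p) k l
      + m * ((rho w.1 *m Gam s p) i j * (rho w.2 *m Gam s' p) k l))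
   - \sum_(w <- C12)
     ((Gam s p *m rho (Rop w.1)) i j * (Gam s' p *m rho w.2) k l
      + m * ((Gam s p *m rho w.1) i j * (Gam s' p *m rho w.2) k l))).
Proof.
move=> s'E mE; rewrite Gamma_bracket_integral.
set h := fun r => \sum_(w <- C12) _.
have hi : cci h.
  apply: cci_sum => w; apply: cciM; first exact: phi_bc.
  apply: (@cci_clin _ _ (fun r x => phi s p i j r x)) => //.
  - by move=> r; exact: phi_lin.
  - by move=> y; exact: phi_bc.
  - apply: (continuous_integrable_br br_lie) => // a; exact: bcont_cst.
(* The primitive differentiates to -h, so its opposite is a primitive of h. *)
have d r : cderive (fun r => -1 * bracket_prim m s s' p i j k l r) r (h r).
  by have := cderiveZ (-1) (bracket_prim_derive p i j k l r s'E mE);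
    rewrite mulN1r opprK.
have [v [vN vy]] := cFTC_line d hi.
have cvg_lim (F : set_system R) (FF : ProperFilter F) (b1 b2 : g -> R[i]) :
    (forall x, ccvg F (fun r => sandwich (Pp s p r) (Qq s p r) i j x) (b1 x)) ->
    (forall x, ccvg F (fun r => sandwich (Pp s' p r) (Qq s' p r) k l x) (b2 x)) ->
    ccvg F (fun r => -1 * bracket_prim m s s' p i j k l r)
     (-1 * ((gamma%:C)%C * \sum_(w <- C12)
        (b1 (Rop w.1) * b2 w.2 + m * (b1 w.1 * b2 w.2)))).
  move=> h1 h2; apply: ccvgM; first exact: ccvg_cst.
  apply: ccvgM; first exact: ccvg_cst.
  apply: ccvg_sum => w; apply: ccvgD; first exact: ccvgM.
  by apply: ccvgM; [exact: ccvg_cst|exact: ccvgM].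
have vNE := ccvg_unique vN (cvg_lim _ _ _ _
  (sandwich_cvgNy s p i j) (sandwich_cvgNy s' p k l)).
have vyE := ccvg_unique vy (cvg_lim _ _ _ _
  (sandwich_cvgy s p i j) (sandwich_cvgy s' p k l)).
(* v is the limit at -oo and v + \int h the limit at +oo of minus the primitive, so this difference
   is its boundary term. *)
have -> : - Cintegral h = v - (v + Cintegral h) by rewrite opprD addrA subrr add0r.
by rewrite vyE vNE !mulN1r opprK addrC -mulrBr.
Qed.

Lemma mul12E (A B : 'M[R[i]]_N) : mul12 A B = A *t B.
Proof. by rewrite /mul12 tensmx_mul mulmx1 mul1mx. Qed.

Lemma rho2_mulE (t : tens2 g) (A B : 'M[R[i]]_N) a b :
  (rho2 rho t *m mul12 A B) a b = \sum_(z <- t)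
     (rho z.1 *m A) (mxtens_unindex a).1 (mxtens_unindex b).1 *
     (rho z.2 *m B) (mxtens_unindex a).2 (mxtens_unindex b).2.
Proof.
rewrite mul12E /rho2 mulmx_suml summxE; apply: eq_bigr => z _.
by rewrite tensmx_mul mxE.
Qed.

Lemma mul_rho2E (t : tens2 g) (A B : 'M[R[i]]_N) a b :
  (mul12 A B *m rho2 rho t) a b = \sum_(z <- t)
     (A *m rho z.1) (mxtens_unindex a).1 (mxtens_unindex b).1 *
     (B *m rho z.2) (mxtens_unindex a).2 (mxtens_unindex b).2.
Proof.
rewrite mul12E /rho2 mulmx_sumr summxE; apply: eq_bigr => z _.
by rewrite tensmx_mul mxE.
Qed.

Lemma clin_rho_mul (A : 'M[R[i]]_N) i j : clin (fun x => (rho x *m A) i j).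
Proof.
have := sandwich_lin 1%:M A i j; congr clin.
by apply/funext => x; rewrite /sandwich mul1mx.
Qed.

Lemma clin_mul_rho (A : 'M[R[i]]_N) i j : clin (fun x => (A *m rho x) i j).
Proof.
have := sandwich_lin A 1%:M i j; congr clin.
by apply/funext => x; rewrite /sandwich mulmx1.
Qed.

Lemma pb12_Gamma (m : R[i]) s s' p :
  pm s' c = pm s c - m * 2 -> m * (m - pm s c) = 0 ->
  pb12 pb (fun q => Gam s q) (fun q => Gam s' q) p = (gamma%:C)%C *:
    mx_comm (rho2 rho R12 + m *: rho2 rho C12) (mul12 (Gam s p) (Gam s' p)).
Proof.
move=> s'E mE; apply/matrixP => a b; rewrite mxE (Gamma_bracket _ _ _ _ _ s'E mE).
rewrite mxE; congr (_ * _); rewrite /mx_comm mulmxDl mulmxDr -scalemxAl -scalemxAr.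
rewrite [RHS]mxE [X in _ = _ + X]mxE [X in _ = X - _]mxE [X in _ = _ - X]mxE.
rewrite [X in _ = _ + X - _]mxE [X in _ = _ - (_ + X)]mxE.
rewrite !rho2_mulE !mul_rho2E !big_split /= -!mulr_sumr.
(* R_{12} is R acting on the first factor of the Casimir tensor, the form in which the boundary
   terms appear. *)
have kE f h : clin f -> clin h -> \sum_(z <- R12) f z.1 * h z.2 =
    \sum_(w <- C12) f (Rop w.1) * h w.2.
  by move=> hf hh; exact: (kernelE br_lie C12_kernel hf hh Rop_lin R12_kernel).
by rewrite (kE _ _ (clin_rho_mul _ _ _) (clin_rho_mul _ _ _))
  (kE _ _ (clin_mul_rho _ _ _) (clin_mul_rho _ _ _)).
Qed.

End Monodromy.

Theorem mainTheorem3
    (R : realType)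
    (g : vectType R) (br : g -> g -> g)
    (br_lie : is_lie_bracket br) (g_ss : lie_semisimple br)
    (c : R[i]) (c_1i : c = 1 \/ c = ('i)%C)
    (Rop : 'End(g)) (R_skew : killing_skew br Rop) (R_mCYBE : mCYBE br c Rop)
    (C12 R12 : tens2 g)
    (C12_kernel : is_kernel br C12 id) (R12_kernel : is_kernel br R12 Rop)
    (gamma : R)
    (N : nat) (rho : g -> 'M[R[i]]_N) (rho_rep : is_lie_rep br rho)
    (G : set 'M[R[i]]_N) (G_lie : is_matrix_lie_group rho G)
    (P : Type) (Obs : set (P -> R[i]))
    (pb : (P -> R[i]) -> (P -> R[i]) -> P -> R[i])
    (Obs_poisson : is_poisson_algebra Obs pb)
    (gf : P -> R -> 'M[R[i]]_N) (X : P -> R -> g)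
    (gf_G : forall p x, G (gf p x)) (gf_cont : forall p, mx_continuous (gf p))
    (X_int : forall p, continuous_integrable (X p))
    (X_infty : forall p, vanishes_at_infinity (X p))
    (g_obs : forall h i j, test_fun h -> Obs (g_smeared gf h i j))
    (X_obs : forall b, g_test_fun b -> Obs (X_smeared br X b))
    (gg : bracket_gg gf pb)
    (Xg : bracket_Xg br rho gf X pb C12)
    (XX : bracket_XX br X pb C12)
    (T : bool -> P -> R -> R -> 'M[R[i]]_N)
    (T_Pexp : forall s p, is_Pexp
       (fun x => rhoC rho (gC_scale (gamma%:C)%C (Rpm Rop c s (gC_of (X p x)))))
       (T s p))
    (T_obs : forall s i j, Obs (fun p => T_line (T s p) i j))
    (T_var : forall s, variation_formula br X pb Obs
       (fun x => rhoC rho (gC_scale (gamma%:C)%C (Rpm Rop c s x))) (T s)) :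
  let Gamma s p := T_line (T s p) in
  let R12mx := rho2 rho R12 in
  let Rpm12mx s := rho2 rho R12 + pm s c *: rho2 rho C12 in
  forall (p : P) (s : bool),
    pb12 pb (Gamma s) (Gamma s) p
      = (gamma%:C)%C *: mx_comm R12mx (mul12 (Gamma s p) (Gamma s p)) /\
    pb12 pb (Gamma s) (Gamma (~~ s)) p
      = (gamma%:C)%C *: mx_comm (Rpm12mx s) (mul12 (Gamma s p) (Gamma (~~ s) p)).
Proof.
move=> Gamma R12mx Rpm12mx p s.
have general := pb12_Gamma br_lie c_1i R_skew R_mCYBE C12_kernel R12_kernel rho_rep
  Obs_poisson X_int X_obs XX T_Pexp T_obs T_var.
split.
  (* Equal signs: m = 0, and no Casimir term is added. *)
  have := general 0 s s p; rewrite scale0r addr0; apply.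
    by rewrite mul0r subr0.
  by rewrite mul0r.
(* Opposite signs: m = [pm s c], so that R_{12} + m C_{12} is the kernel of R^s and [pm s c] - 2 m =
   - [pm s c]. *)
apply: general; last by rewrite subrr mulr0.
by rewrite /pm; case: s => /=; rewrite expr0 expr1; ring.
Qed.
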